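(* Let $\lambda\in\mathcal M(\mathbb R^d;\mathbb R^d)$. Then there exists a unique $\lambda_T\in\mathbf F_1(\mathbb R^d)$ solving the minimal distance problem $$\|\lambda-\lambda_T\|=\inf\{\|\eta-\lambda\| : \eta\in\mathbf F_1(\mathbb R^d)\}=:\operatorname{dist}(\lambda,\mathbf F_1(\mathbb R^d)).$$ Moreover, the projection map $\mathcal P_{\mathbf F}:\lambda\in\mathcal M(\mathbb R^d;\mathbb R^d)\mapsto\lambda_T\in\mathbf F_1(\mathbb R^d)$ is linear and $1$-Lipschitz. Accordingly, one has the topological direct sum $$\mathcal M(\mathbb R^d;\mathbb R^d)=\mathbf F_1(\mathbb R^d)\oplus\mathbf F_1^\perp(\mathbb R^d),$$ where $$\mathbf F_1^\perp(\mathbb R^d):=\ker\mathcal P_{\mathbf F}=\Big\{\lambda\in\mathcal M(\mathbb R^d;\mathbb R^d) : \tfrac{d\lambda}{d|\lambda|}(x)\in N_{|\lambda|}(x)\ \text{ for } |\lambda|\text{-a.e. } x\Big\}.$$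
   Context: $\mathcal D(\mathbb R^d)$ is the space of smooth compactly supported functions, $\operatorname{Lip}(\mathbb R^d)$ the space of real Lipschitz functions, $\operatorname{Lip}_1(\mathbb R^d)$ those with Lipschitz constant at most $1$. $\mathcal M(\mathbb R^d;\mathbb R^d)$ is the space of finite $\mathbb R^d$-valued Borel measures with the total variation norm $\|\lambda\|=|\lambda|(\mathbb R^d)$. Let $\mathcal M_{0,1}(\mathbb R^d)$ be the finite signed Borel measures $f$ with $\int df=0$ and $\int|x|\,d|f|<\infty$, with norm $\|f\|_{\mathrm{KR}}=\sup\{\int u\,df: u\in\operatorname{Lip}_1(\mathbb R^d)\}$. The Arens-Eells space $\mathrm{AE}(\mathbb R^d)$ is the completion of $\mathcal M_{0,1}(\mathbb R^d)$ for this norm, identified with a subspace of distributions: $f\in\mathcal D'(\mathbb R^d)$ belongs to $\mathrm{AE}(\mathbb R^d)$ iff $\langle f,\varphi_n\rangle\to0$ for every sequence $(\varphi_n)\subset\mathcal D(\mathbb R^d)$ with $\sup_n\|\nabla\varphi_n\|_\infty<\infty$ and $\varphi_n\to c$ pointwise for some constant $c\in\mathbb R$. $\mathbf F_1(\mathbb R^d):=\{\lambda\in\mathcal M(\mathbb R^d;\mathbb R^d): -\operatorname{div}\lambda\in\mathrm{AE}(\mathbb R^d)\}$ (flat chains of finite mass; $\langle-\operatorname{div}\lambda,\varphi\rangle=\int\nabla\varphi\cdot d\lambda$). For a nonnegative Radon measure $\mu$ on $\mathbb R^d$, set $\mathcal T_\mu:=\{\sigma\in(L^1_\mu(\mathbb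 R^d))^d: -\operatorname{div}(\sigma\mu)\in\mathrm{AE}(\mathbb R^d)\}$. There is a $\mu$-measurable map $x\mapsto T_\mu(x)$ valued in the linear subspaces of $\mathbb R^d$, unique up to $\mu$-null sets, such that for $\sigma\in(L^1_\mu)^d$: $\sigma\in\mathcal T_\mu\iff\sigma(x)\in T_\mu(x)$ for $\mu$-a.e. $x$. This is the MK (Monge-Kantorovich) tangent bundle, and $N_\mu(x):=T_\mu(x)^\perp$. *)

(* Defs.v *)
From HB Require Import structures.
From mathcomp Require Import all_boot all_order all_algebra.
From mathcomp Require Import ring lra zify.
From mathcomp Require Import all_classical all_reals all_analysis.
Set Implicit Arguments.
Unset Strict Implicit.
Unset Printing Implicit Defensive.
Import Order.TTheory GRing.Theory Num.Theory.
Import numFieldNormedType.Exports.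
Local Open Scope classical_set_scope.
Local Open Scope ring_scope.

Section euclidean.
Context {R : realType} {n : nat}.
Implicit Types u v : 'rV[R]_n.

(* The norm of the library on ['rV_n] is the sup norm, hence this one. *)
Definition dotv u v : R := \sum_i u 0 i * v 0 i.
Definition enorm u : R := Num.sqrt (dotv u u).

Lemma dotvv_ge0 u : 0 <= dotv u u.
Proof. by apply: sumr_ge0 => i _; rewrite -expr2 sqr_ge0. Qed.

Lemma enorm_ge0 u : 0 <= enorm u. Proof. exact: sqrtr_ge0. Qed.

Lemma enorm_sqr u : enorm u ^+ 2 = dotv u u.
Proof. by rewrite sqr_sqrtr// dotvv_ge0. Qed.

Lemma coord_le_enorm u i : `|u 0 i| <= enorm u.
Proof.
rewrite -sqrtr_sqr ler_wsqrtr// /dotv (bigD1 i)//= expr2 lerDl.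
by apply: sumr_ge0 => j _; rewrite -expr2 sqr_ge0.
Qed.

Lemma enorm_eq0 u : enorm u = 0 -> u = 0.
Proof.
move=> u0; apply/rowP => i; apply/eqP.
by rewrite mxE -normr_le0 -u0 coord_le_enorm.
Qed.

Lemma enormZ (a : R) u : enorm (a *: u) = `|a| * enorm u.
Proof.
rewrite /enorm -sqrtr_sqr -sqrtrM ?sqr_ge0//; congr Num.sqrt.
by rewrite /dotv mulr_sumr; apply: eq_bigr => i _; rewrite mxE mulrACA.
Qed.

Lemma enorm0 : enorm 0 = 0.
Proof. by rewrite -(scale0r 0) enormZ normr0 mul0r. Qed.

Lemma dotv_le u v : dotv u v <= enorm u * enorm v.
Proof.
have [->|u0] := eqVneq u 0.
  by rewrite enorm0 mul0r /dotv big1// => i _; rewrite mxE mul0r.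
have [->|v0] := eqVneq v 0.
  by rewrite enorm0 mulr0 /dotv big1// => i _; rewrite mxE mulr0.
have p x : x != 0 -> 0 < enorm x.
  by move=> x0; rewrite lt_neqAle enorm_ge0 andbT; apply: contra x0 => /eqP/esym/enorm_eq0 ->.
have ab : 0 < enorm u * enorm v by rewrite mulr_gt0// p.
have := dotvv_ge0 (enorm v *: u - enorm u *: v).
have -> : dotv (enorm v *: u - enorm u *: v) (enorm v *: u - enorm u *: v) =
    enorm v ^+ 2 * dotv u u + enorm u ^+ 2 * dotv v v
    - (enorm u * enorm v) * dotv u v *+ 2.
  rewrite /dotv !mulr_sumr -sumrMnl -sumrN -!big_split/=.
  by apply: eq_bigr => i _; rewrite !mxE; ring.
rewrite -!enorm_sqr.
have -> : enorm v ^+ 2 * enorm u ^+ 2 + enorm u ^+ 2 * enorm v ^+ 2 -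
  enorm u * enorm v * dotv u v *+ 2 =
  (enorm u * enorm v) * (enorm u * enorm v - dotv u v) *+ 2 by ring.
by rewrite pmulrn_lge0// pmulr_rge0// subr_ge0.
Qed.

Lemma enormD u v : enorm (u + v) <= enorm u + enorm v.
Proof.
rewrite -(@ler_pXn2r _ 2)// ?nnegrE ?addr_ge0 ?enorm_ge0//.
have -> : enorm (u + v) ^+ 2 = enorm u ^+ 2 + enorm v ^+ 2 + dotv u v *+ 2.
  rewrite !enorm_sqr /dotv -sumrMnl -!big_split/=.
  by apply: eq_bigr => i _; rewrite !mxE; ring.
by rewrite sqrrD addrAC lerD2r lerD2l lerMn2r dotv_le orbT.
Qed.

Lemma enorm_sum I (r : seq I) (P : pred I) (F : I -> 'rV[R]_n) :
  enorm (\sum_(i <- r | P i) F i) <= \sum_(i <- r | P i) enorm (F i).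
Proof.
elim/big_ind2 : _ => [|x1 x2 y1 y2 h1 h2|//]; first by rewrite enorm0.
by rewrite (le_trans (enormD _ _))// lerD.
Qed.

Lemma enorm_le_coord u : enorm u <= \sum_i `|u 0 i|.
Proof.
have {1}-> : u = \sum_i u 0 i *: delta_mx 0 i by rewrite -row_sum_delta.
apply: le_trans (enorm_sum _ _ _) _; apply: ler_sum => i _.
rewrite enormZ ler_piMr// /enorm /dotv (bigD1 i)//= !mxE !eqxx mulr1.
rewrite big1 ?addr0 ?sqrtr1// => j ji.
by rewrite !mxE (negbTE ji) andbF mul0r.
Qed.

Lemma enorm_continuous : continuous enorm.
Proof.
move=> u; have h : dotv v v @[v --> u] --> dotv u u.
  rewrite /dotv; elim: (index_enum _) => [|i r ih].
    rewrite big_nil; under eq_fun do rewrite big_nil.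
    by apply: cvg_cst; exact: nbhs_filter.
  rewrite big_cons; under eq_fun do rewrite big_cons.
  by apply: cvgD ih; apply: cvgM; exact: coord_continuous.
exact: (cvg_comp _ _ h (@sqrt_continuous R _)).
Qed.
End euclidean.

Section vmeasure.
Context {d : measure_display} {T : measurableType d} {R : realType} {n : nat}.

(* The value 0 imposed outside the sigma-algebra makes Leibniz equality the
   equality of vector measures. *)
Definition is_vmeasure (m : set T -> 'rV[R]_n) : Prop :=
  (forall A, ~ measurable A -> m A = 0) /\
  (forall F : (set T)^nat, (forall i, measurable (F i)) -> trivIset setT F ->
    \sum_(0 <= i < k) m (F i) @[k --> \oo] --> m (\bigcup_i F i)).

Definition vmeasure_pred : {pred set T -> 'rV[R]_n} :=
  [pred m | `[< is_vmeasure m >]].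

Lemma vmeasure_submod_closed : submod_closed vmeasure_pred.
Proof.
split=> [|a l m /asboolP[l0 lF] /asboolP[m0 mF]]; apply/asboolP; split => //.
- move=> F _ _; under eq_fun do rewrite big1//; exact: cvg_cst.
- move=> A mA; rewrite [LHS](_ : _ = a *: l A + m A)//.
  by rewrite l0// m0// scaler0 addr0.
- move=> F mFi tF.
  rewrite [X in _ --> X](_ : _ = a *: l (\bigcup_i F i) + m (\bigcup_i F i))//.
  rewrite (_ : (fun k => _) = fun k =>
      a *: (\sum_(0 <= i < k) l (F i)) + \sum_(0 <= i < k) m (F i)); last first.
    by apply/funext => k; rewrite scaler_sumr -big_split.
  by apply: cvgD; [apply: cvgZr; exact: lF|exact: mF].
Qed.

HB.instance Definition _ := GRing.isSubmodClosed.Build _ _ vmeasure_pred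
  vmeasure_submod_closed.
End vmeasure.

Record vmeasure {d : measure_display} (T : measurableType d) (R : realType)
  (n : nat) := VMeasure {
    vmeasure_fun :> set T -> 'rV[R]_n ;
    vmeasure_inP : vmeasure_fun \in vmeasure_pred }.

Section vmeasure_lmod.
Context {d : measure_display} (T : measurableType d) (R : realType) (n : nat).
HB.instance Definition _ := [isSub for @vmeasure_fun d T R n].
HB.instance Definition _ := [Choice of vmeasure T R n by <:].
HB.instance Definition _ := [SubChoice_isSubLmodule of vmeasure T R n by <:].
End vmeasure_lmod.

Section total_variation.
Context {d : measure_display} {T : measurableType d} {R : realType} {n : nat}.
Implicit Types m : vmeasure T R n.
Local Open Scope ereal_scope.

Lemma vmeasureP m : is_vmeasure m.
Proof. exact/asboolP/(vmeasure_inP m). Qed.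

Lemma vmeasure0 m : m set0 = 0%R.
Proof.
have t0 : trivIset [set: nat] (fun=> @set0 T).
  by apply/trivIsetP => i j _ _ _; rewrite setI0.
have [_ /(_ (fun=> set0) (fun=> measurable0) t0)] := vmeasureP m.
rewrite bigcup0// => h.
have h2 : m set0 @[k --> \oo] --> (0 : 'rV[R]_n)%R.
  apply: (@cvg_series_cvg_0 _ _ (fun=> m set0)).
  by apply: (cvgP (m set0)); exact: h.
have h3 : m set0 @[k --> \oo] --> m set0 by apply: cvg_cst.
exact: (cvg_unique (@norm_hausdorff _ _) h3 h2).
Qed.

Definition vcoord m (i : 'I_n) : set T -> \bar R := fun A => (m A 0%R i)%:E.

Let vcoord0 m i : vcoord m i set0 = 0.
Proof. by rewrite /vcoord vmeasure0 mxE. Qed.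

Let vcoord_fin m i A : measurable A -> vcoord m i A \is a fin_num.
Proof. by []. Qed.

Let vcoord_sigma m i : semi_sigma_additive (vcoord m i).
Proof.
move=> F mF tF _; rewrite /vcoord.
under eq_fun do rewrite sumEFin -summxE.
apply: cvg_EFin; first exact: nearW.
have [_ /(_ F mF tF) h] := vmeasureP m.
exact: (cvg_comp _ _ h (@coord_continuous _ _ _ 0%R i _)).
Qed.

HB.instance Definition _ m i := isCharge.Build _ _ _ (vcoord m i)
  (vcoord0 m i) (@vcoord_fin m i) (@vcoord_sigma m i).

(* The disjoint sets are only required to be included in [A]: on measurable
   sets this gives the usual supremum over finite measurable partitions of [A],
   since the remainder of [A] can be added to the family. *)
Definition tvar m (A : set T) : \bar R :=
  ereal_sup [set x | exists k (F : (set T)^nat),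
    [/\ forall i, measurable (F i), trivIset setT F, \bigcup_i F i `<=` A &
        x = \sum_(i < k) (enorm (m (F i)))%:E]].

Let tvar_ge0 m A : 0 <= tvar m A.
Proof.
apply: ereal_sup_ubound => /=; exists 0%N, (fun=> set0); split => //.
- by apply/trivIsetP => ? ? _ _ _; rewrite setI0.
- by rewrite bigcup0.
- by rewrite big_ord0.
Qed.


Let tvar_le m A x : (forall k (F : (set T)^nat), (forall i, measurable (F i)) ->
    trivIset setT F -> \bigcup_i F i `<=` A ->
    \sum_(i < k) (enorm (m (F i)))%:E <= x) -> tvar m A <= x.
Proof. by move=> h; apply: ge_ereal_sup => _ [k [F [mF tF FA ->]]]; exact: h. Qed.

Let le_tvar m A k (F : (set T)^nat) : (forall i, measurable (F i)) ->
    trivIset setT F -> \bigcup_i F i `<=` A ->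
  \sum_(i < k) (enorm (m (F i)))%:E <= tvar m A.
Proof. by move=> mF tF FA; apply: ereal_sup_ubound; exists k, F. Qed.

Lemma enorm_le_tvar m A : measurable A -> (enorm (m A))%:E <= tvar m A.
Proof.
move=> mA.
have := @le_tvar m A 1 (fun i => if i is 0%N then A else set0).
rewrite big_ord1; apply.
- by case.
- by apply/trivIsetP => -[|i] [|j]//= _ _ _; rewrite ?setI0 ?set0I.
- by move=> x [[]].
Qed.

Let charge_bounded (nu : {charge set T -> \bar R}) : exists M : R,
  forall k (F : (set T)^nat), (forall i, measurable (F i)) -> trivIset setT F ->
  \sum_(i < k) `|nu (F i)| <= M%:E.
Proof.
have [P [N PN]] := Hahn_decomposition nu.
exists (fine (charge_variation PN setT)) => k F mF tF.
rewrite fineK ?fin_num_measure//.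
apply: (@le_trans _ _ (\sum_(i < k) charge_variation PN (F i))).
  by apply: lee_sum => i _; exact: abse_charge_variation.
rewrite -measure_bigsetU// le_measure// inE//.
exact: bigsetU_measurable.
Qed.

Let tvar_fin m A : tvar m A \is a fin_num.
Proof.
have /choice[M hM] := fun c => charge_bounded (vcoord m c).
rewrite ge0_fin_numE; last exact: tvar_ge0.
apply: (@le_lt_trans _ _ (\sum_c M c)%:E); last exact: ltry.
apply: tvar_le => k F mF tF _.
apply: (@le_trans _ _ (\sum_(i < k) \sum_c `|vcoord m c (F i)|)).
  apply: lee_sum => i _; rewrite sumEFin lee_fin; exact: enorm_le_coord.
by rewrite exchange_big/= -sumEFin; apply: lee_sum => c _; exact: hM.
Qed.

Let tvar_super m A B C : A `&` B = set0 -> A `|` B `<=` C ->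
  tvar m A + tvar m B <= tvar m C.
Proof.
move=> AB0 ABC.
rewrite -leeBrDr ?tvar_fin//; apply: tvar_le => k F mF tF FA.
rewrite leeBrDr ?tvar_fin// addeC -leeBrDr ?sumEFin//.
apply: tvar_le => l G mG tG GB.
rewrite leeBrDr//.
pose H i := if (i < k)%N then F i else G (i - k)%N.
have FG i j : F i `&` G j = set0.
  rewrite -subset0 -AB0 => x [Fx Gx].
  by split; [apply: FA; exists i|apply: GB; exists j].
have HF : (\sum_(i < k) enorm (m (F i)))%:E = \sum_(i < k) (enorm (m (H i)))%:E.
  by rewrite -sumEFin; apply: eq_bigr => i _; rewrite /H ltn_ord.
have HG : \sum_(i < l) (enorm (m (G i)))%:E =
    \sum_(i < l) (enorm (m (H (k + i)%N)))%:E.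
  by apply: eq_bigr => i _; rewrite /H ltnNge leq_addr/= addKn.
have := @le_tvar m C (k + l) H; rewrite big_split_ord/= addeC -HF -HG; apply.
- by move=> i; rewrite /H; case: ifP.
- apply/trivIsetP => i j _ _ ij; rewrite /H.
  case: ltnP => ik; case: ltnP => jk => //.
  + by move/trivIsetP : tF; exact.
  + by rewrite setIC.
  + by move/trivIsetP : tG; apply=> //; move: ij; apply: contra => /eqP; lia.
- move=> x [i _]; rewrite /H; case: ifP => _ xi; apply: ABC.
  + by left; apply: FA; exists i.
  + by right; apply: GB; exists (i - k)%N.
Qed.

Let enorm_bigcup m (F : (set T)^nat) : (forall i, measurable (F i)) ->
  trivIset setT F ->
  (enorm (m (\bigcup_i F i)))%:E <= \sum_(i <oo) (enorm (m (F i)))%:E.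
Proof.
move=> mF tF; have [_ /(_ F mF tF) h] := vmeasureP m.
have h1 : (enorm (\sum_(0 <= i < k) m (F i))%R)%:E @[k --> \oo] -->
    (enorm (m (\bigcup_i F i)))%:E.
  apply: cvg_EFin; first exact: nearW.
  exact: (cvg_comp _ _ h (@enorm_continuous _ _ _)).
rewrite -(cvg_lim _ h1)//; apply: lime_le; first by apply/cvg_ex; eexists; exact: h1.
apply: nearW => k; apply: le_trans (nneseries_lim_ge k _); last first.
  by move=> i _ _; rewrite lee_fin enorm_ge0.
by rewrite sumEFin lee_fin enorm_sum.
Qed.

Let tvar0 m : tvar m set0 = 0.
Proof.
apply/eqP; rewrite eq_le tvar_ge0 andbT; apply: tvar_le => k F _ _ F0.
rewrite big1// => i _; have -> : F i = set0.
  by apply/seteqP; split => // x Fx; apply: F0; exists i.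
by rewrite vmeasure0 enorm0.
Qed.

Let tvar_sigma m : semi_sigma_additive (tvar m).
Proof.
move=> A mA tA _.
rewrite [X in _ --> X](_ : _ = \sum_(j <oo) tvar m (A j)); last first.
  apply/eqP; rewrite eq_le; apply/andP; split.
    apply: tvar_le => k F mF tF FA.
    apply: (@le_trans _ _
        (\sum_(i < k) \sum_(j <oo) (enorm (m (F i `&` A j)))%:E)).
      apply: lee_sum => i _.
      rewrite [X in m X](_ : F i = \bigcup_j (F i `&` A j)); last first.
        by rewrite -setI_bigcupr setIidl// => x Fx; apply: FA; exists i.
      apply: enorm_bigcup; first by move=> j; exact: measurableI.
      exact: trivIset_setIl.
    rewrite -nneseries_sum; last by move=> i j _; rewrite lee_fin enorm_ge0.
    apply: lee_nneseries => [j _ _|j _].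
      by apply: sume_ge0 => i _; rewrite lee_fin enorm_ge0.
    apply: (@le_tvar m (A j) k (fun i => F i `&` A j)).
    - by move=> i; exact: measurableI.
    - exact: trivIset_setIr.
    - by move=> x [i _ []].
  apply: lime_le; first by apply: is_cvg_nneseries.
  apply: nearW => k.
  apply: (@le_trans _ _ (tvar m (\big[setU/set0]_(j < k) A j))); last first.
    rewrite -[leLHS]add0e -(tvar0 m); apply: tvar_super; first by rewrite set0I.
    by rewrite set0U; exact: bigsetU_bigcup.
  elim: k => [|k ih]; first by rewrite big_nil tvar_ge0.
  rewrite big_nat_recr//= (le_trans (leeD2r _ ih))// tvar_super//.
    by apply: (@trivIset_bigsetUI _ predT) => //; rewrite /predT /= trueE.
  by rewrite big_ord_recr.
by apply: cvg_toP => //; exact: is_cvg_nneseries.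
Qed.

HB.instance Definition _ m := isMeasure.Build _ _ _ (tvar m)
  (tvar0 m) (tvar_ge0 m) (@tvar_sigma m).
HB.instance Definition _ m := Measure_isFinite.Build _ _ _ (tvar m)
  (fun A _ => tvar_fin m A).

Lemma vcoord_dominated m i : vcoord m i `<< tvar m.
Proof.
apply/null_content_dominatesP => A mA A0.
have := enorm_le_tvar m mA; rewrite A0 lee_fin => h.
by apply/eqP; rewrite eqe -normr_le0 (le_trans (coord_le_enorm _ _)).
Qed.

Local Open Scope charge_scope.

(* The density dm/d|m|; the Radon-Nikodym derivatives below are not default
   values, by [vcoord_dominated]. *)
Definition polar m : T -> 'rV[R]_n :=
  fun x => \row_i fine ('d (vcoord m i) '/d (tvar m) x).
End total_variation.

Section vmeasure_norm.
Context {d : measure_display} {T : measurableType d} {R : realType} {n : nat}.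
Implicit Types m : vmeasure T R n.

Definition vnorm m : R := fine (tvar m setT).

Let tvarT_fin m : tvar m setT \is a fin_num.
Proof. exact: fin_num_measure. Qed.

Let vnormD m l : vnorm (m + l) <= vnorm m + vnorm l.
Proof.
rewrite -lee_fin EFinD !fineK//.
apply: ge_ereal_sup => _ [k [F [mF tF FT ->]]].
apply: (@le_trans _ _ (\sum_(i < k) (enorm (m (F i)))%:E +
    \sum_(i < k) (enorm (l (F i)))%:E)%E).
  by rewrite -big_split/=; apply: lee_sum => i _; rewrite lee_fin enormD.
by apply: leeD; apply: ereal_sup_ubound; exists k, F.
Qed.

Let vnormZ_le (a : R) m : vnorm (a *: m) <= `|a| * vnorm m.
Proof.
rewrite -lee_fin EFinM !fineK//.
apply: ge_ereal_sup => _ [k [F [mF tF FT ->]]].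
under eq_bigr do rewrite enormZ EFinM.
rewrite -ge0_sume_distrr; last by move=> i _; rewrite lee_fin enorm_ge0.
by rewrite lee_wpmul2l// ereal_sup_ubound//; exists k, F.
Qed.

Let vnormZ (a : R) m : vnorm (a *: m) = `|a| * vnorm m.
Proof.
apply/eqP; rewrite eq_le vnormZ_le/=.
have [->|a0] := eqVneq a 0.
  by rewrite normr0 mul0r scale0r; apply: fine_ge0; exact: measure_ge0.
rewrite -ler_pdivlMl ?normr_gt0// -normfV.
by rewrite -[leLHS](congr1 vnorm (scalerK a0 m)) vnormZ_le.
Qed.

Let vnorm0_eq0 m : vnorm m = 0 -> m = 0.
Proof.
move=> m0; apply/val_inj/funext => A /=.
have [mA|mA] := pselect (measurable A); last by rewrite (vmeasureP m).1.
apply: enorm_eq0; apply/eqP; rewrite eq_le enorm_ge0 andbT -lee_fin.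
apply: (le_trans (enorm_le_tvar m mA)); rewrite -m0 fineK//.
by apply: le_measure => //; rewrite inE.
Qed.

HB.instance Definition _ := Lmodule_isNormed.Build R (vmeasure T R n)
  vnormD vnormZ vnorm0_eq0.
End vmeasure_norm.

Section topological_direct_sum.
Context {R : realType} {V : normedModType R}.

Definition is_subspace (A : set V) : Prop :=
  A 0 /\ forall (a : R) u v, A u -> A v -> A (a *: u + v).

Definition topological_direct_sum (A B : set V) : Prop :=
  [/\ is_subspace A, is_subspace B &
    exists pA pB : V -> V, [/\ continuous pA, continuous pB &
      forall v, [/\ A (pA v), B (pB v), v = pA v + pB v &
        forall a b, A a -> B b -> v = a + b -> a = pA v /\ b = pB v]]].

Definition dist (v : V) (A : set V) : R := inf [set `|a - v| | a in A].
End topological_direct_sum.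

Section distributions.
Context {R : realType} {d : nat}.
Local Notation Rd := 'rV[R]_d.
Implicit Types f : Rd -> R.

Definition partial (i : 'I_d) f : Rd -> R := fun x => 'D_(delta_mx 0 i) f x.
Definition partials (s : seq 'I_d) f : Rd -> R := foldr partial f s.
Definition grad f : Rd -> Rd := fun x => \row_i partial i f x.

Definition smooth f : Prop := forall s : seq 'I_d,
  continuous (partials s f) /\
  forall i x, derivable (partials s f) x (delta_mx 0 i).

Definition tsupport f : set Rd := closure [set x | f x != 0].

Definition test_function : set (Rd -> R) :=
  [set f | smooth f /\ compact (tsupport f)].

Definition test_cvg0 (phi : (Rd -> R)^nat) : Prop :=
  (exists2 K : set Rd, compact K & forall n, tsupport (phi n) `<=` K) /\
  forall (s : seq 'I_d) (e : R), 0 < e ->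
    \forall n \near \oo, forall x, `|partials s (phi n) x| <= e.

(* Functionals are total on [Rd -> R], but only their values on test functions
   are constrained. *)
Definition distribution (F : (Rd -> R) -> R) : Prop :=
  (forall (a : R) f g, test_function f -> test_function g ->
    F (a *: f + g) = a * F f + F g) /\
  (forall phi : (Rd -> R)^nat, (forall n, test_function (phi n)) ->
    test_cvg0 phi -> F (phi n) @[n --> \oo] --> 0).

(* AE(R^d) as a space of distributions: the sequential condition characterizes
   the distributions in the Kantorovich-Rubinstein completion of the balanced
   measures with finite first moment. *)
Definition arens_eells : set ((Rd -> R) -> R) := [set F | distribution F /\
  forall (phi : (Rd -> R)^nat) (c : R), (forall n, test_function (phi n)) ->
    (exists L : R, forall n x, enorm (grad (phi n) x) <= L) ->
    (forall x, phi n x @[n --> \oo] --> c) ->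
    F (phi n) @[n --> \oo] --> 0].
End distributions.

Definition borelRd (R : realType) (d : nat) :=
  g_sigma_algebraType (@open 'rV[R]_d).

Section flat_chains.
Context {R : realType} {d : nat}.
Local Notation Rd := (borelRd R d).
Implicit Types (mu : {measure set Rd -> \bar R}) (sigma : Rd -> 'rV[R]_d)
  (lambda : vmeasure Rd R d).

(* - div (sigma mu) *)
Definition ndiv_density mu sigma : ('rV[R]_d -> R) -> R :=
  fun phi => (\int[mu]_x dotv (grad phi x) (sigma x))%R.

(* - div lambda, where the integral of a vector field against lambda is taken
   through the polar decomposition lambda = (dlambda/d|lambda|) |lambda| *)
Definition ndiv lambda : ('rV[R]_d -> R) -> R :=
  ndiv_density (tvar lambda) (polar lambda).

(* flat chains of finite mass *)
Definition F1 : set (vmeasure Rd R d) := [set lambda | arens_eells (ndiv lambda)].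

Definition L1 mu : set (Rd -> 'rV[R]_d) := [set sigma |
  forall i, mu.-integrable setT (fun x => (sigma x 0 i)%:E)].

Definition tangent_fields mu : set (Rd -> 'rV[R]_d) :=
  [set sigma | L1 mu sigma /\ arens_eells (ndiv_density mu sigma)].

(* measurable for the completion of mu *)
Definition mu_measurable mu (A : set Rd) : Prop :=
  exists2 B, measurable B & mu.-negligible ((A `\` B) `|` (B `\` A)).

(* Measurability of a subspace-valued map is that of multifunctions: the set of
   points whose image meets a given open set is measurable. *)
Definition mu_measurable_bundle mu (T : Rd -> {vspace 'rV[R]_d}) : Prop :=
  forall U : set 'rV[R]_d, open U ->
    mu_measurable mu [set x | exists2 v, v \in T x & U v].

(* T is (a representative of) the Monge-Kantorovich tangent bundle T_mu *)
Definition MK_tangent_bundle mu (T : Rd -> {vspace 'rV[R]_d}) : Prop :=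
  mu_measurable_bundle mu T /\
  forall sigma, L1 mu sigma ->
    (tangent_fields mu sigma <-> {ae mu, forall x, sigma x \in T x}).

Definition orthogonal (U : {vspace 'rV[R]_d}) : set 'rV[R]_d :=
  [set v | forall u, u \in U -> dotv u v = 0].

Definition F1_perp : set (vmeasure Rd R d) := [set lambda |
  exists2 T, MK_tangent_bundle (tvar lambda) T &
    {ae tvar lambda, forall x, orthogonal (T x) (polar lambda x)}].

Definition nearest_in_F1 lambda lambdaT : Prop :=
  F1 lambdaT /\ `|lambda - lambdaT| = dist lambda F1.
End flat_chains.
Arguments F1 : clear implicits.
Arguments F1_perp : clear implicits.

(* Main.v *)
From HB Require Import structures.
Require Import Defs.
From mathcomp Require Import all_boot all_order all_algebra.
From mathcomp Require Import ring lra.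
From mathcomp Require Import all_classical all_reals all_analysis measurable_realfun.
Set Implicit Arguments.
Unset Strict Implicit.
Unset Printing Implicit Defensive.
Import Order.TTheory GRing.Theory Num.Theory.
Import numFieldNormedType.Exports.
Local Open Scope classical_set_scope.
Local Open Scope ring_scope.

(** Fix a finite measure [mu] and call a field [s] tangent when [- div (s mu)] lies
in the Arens-Eells space.  Pairings with test functions of bounded gradient are
controlled by the [L^1] norm, so the tangent fields form a vector space closed under
dominated convergence.  By the Leibniz rule it is a module over the test functions,
hence, by Dynkin's theorem and approximation, over the measurable functions
([tangent_fieldsM]).  Such a closed module is given by pointwise conditions: choosing
one after the other unit tangent fields of largest support, each orthogonal to the
previous ones ([maximal_unit_field]), one gets [d] fields, orthonormal wherever they
do not vanish, such that [s] is tangent if and only if [s x] lies in their span at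
almost every [x] ([tangent_frame_ex]).  This span is the Monge-Kantorovich bundle
([MK_tangent_bundle_span]).

Let [l = s mu], and let [proj s] be the pointwise orthogonal projection of [s] on the
span of the frame.  The nearest flat chain is [(proj s) mu].  Indeed the distance of
two measures with densities [s] and [r] is the integral of [|s - r|]
([tvar_density]), and if [r mu] is a flat chain then Pythagoras' identity
[|s - r|^2 = |s - proj s|^2 + |proj s - r|^2] holds at almost every point.  A general
flat chain is cut along a Borel set into a part absolutely continuous with respect to
[mu], which is again a flat chain by the module property, and a part carried by a
[mu]-null set, which only adds to the distance ([nearest_in_F1P]).

Here [mu] is any finite measure dominating [l].  Two measures can thus be projected by
means of one frame, which shows that the projection is linear; it does not increase
the norm since [|proj s| <= |s|]; and it kills [l] if and only if [s x] is orthogonal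
to the tangent space at almost every [x]. *)

(** * Integrals of real functions *)

Section real_integrals.
Context {d : measure_display} {T : measurableType d} {R : realType}.
Implicit Types (mu nu la : {measure set T -> \bar R}) (f g h : T -> R).

Import HBSimple HBNNSimple.

Let nnsfun_ind (P : (T -> R) -> Prop) :
  (forall A, measurable A -> P \1_A) ->
  (forall a f g, P f -> P g -> P (fun x => a * f x + g x)) ->
  forall f : {nnsfun T >-> R}, P f.
Proof.
move=> P1 PD f.
have P0 : P (fun=> 0).
  have := PD (-1) _ _ (P1 _ measurable0) (P1 _ measurable0).
  by congr P; apply/funext => x; rewrite mulN1r addNr.
have -> : (f : T -> R) =
    fun x => \sum_(y \in range f) y * \1_(f @^-1` [set y]) x.
  by apply/funext => x; rewrite fimfunE.
under eq_fun do rewrite fsbig_finite//=.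
elim: (finmap.enum_fset _) => [|y s ih].
  by under eq_fun do rewrite big_nil.
under eq_fun do rewrite big_cons.
by apply: PD => //; apply: P1; exact: measurable_funPTI.
Qed.

(** Induction on measurable functions.  Linear combinations of indicators approximate
the positive and negative parts from below, whence the domination by [f] itself, which
is what passing to the limit under an integral takes when [f] is unbounded. *)
Lemma measurable_fun_approx (P : (T -> R) -> Prop) :
  (forall A, measurable A -> P \1_A) ->
  (forall a f g, P f -> P g -> P (fun x => a * f x + g x)) ->
  forall f, measurable_fun setT f -> exists g : (T -> R)^nat,
    [/\ forall n, P (g n), forall n, measurable_fun setT (g n),
        forall x, g n x @[n --> \oo] --> f x &
        forall n x, `|g n x| <= `|f x|].
Proof.
move=> P1 PD f mf.
have h g : measurable_fun setT g -> (forall x, 0 <= g x) ->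
    exists p : {nnsfun T >-> R}^nat,
    (forall x, p n x @[n --> \oo] --> g x) /\ forall n x, 0 <= p n x <= g x.
  move=> mg g0.
  have mg' : measurable_fun setT (EFin \o g) by apply/measurable_EFinP.
  exists (nnsfun_approx measurableT mg'); split=> [x|n x].
    under eq_fun do rewrite nnsfun_approxE.
    exact: (@cvg_approx _ _ _ setT (EFin \o g) x (fun x _ => g0 x) Logic.I (ltry _)).
  rewrite fun_ge0 /= nnsfun_approxE -lee_fin.
  exact: (@le_approx _ _ _ setT (EFin \o g) n x (fun x _ => g0 x) Logic.I).
have [p [pf p0]] := h _ (measurable_funrpos mf) (funrpos_ge0 f).
have [q [qf q0]] := h _ (measurable_funrneg mf) (funrneg_ge0 f).
exists (fun n x => -1 * q n x + p n x); split.
- by move=> n; exact: (PD _ _ _ (nnsfun_ind P1 PD (q n)) (nnsfun_ind P1 PD (p n))).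
- move=> n; apply: measurable_funD; last exact: measurable_funPT.
  by apply: measurable_funM => //; exact: measurable_funPT.
- move=> x; rewrite [f x](_ : _ = -1 * f^\- x + f^\+ x); last first.
    by rewrite mulN1r addrC; exact: (esym (congr1 (@^~ x) (funrposBneg f))).
  by apply: cvgD => //; apply: cvgM => //; exact: cvg_cst.
- move=> n x; have /andP[p1 p2] := p0 n x; have /andP[q1 q2] := q0 n x.
  rewrite mulN1r; apply: (@le_trans _ _ (Num.max (f^\+ x) (f^\- x))).
    have m1 : f^\+ x <= Num.max (f^\+ x) (f^\- x) by rewrite le_max lexx.
    have m2 : f^\- x <= Num.max (f^\+ x) (f^\- x) by rewrite le_max lexx orbT.
    by rewrite ler_norml; apply/andP; split; lra.
  rewrite ge_max /funrpos /funrneg.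
  by rewrite !ge_max ler_norm normr_ge0 -normrN ler_norm.
Qed.

Lemma integrable_bounded_mul mu g f (M : R) : measurable_fun setT g ->
  (forall x, `|g x| <= M) -> mu.-integrable setT (EFin \o f) ->
  mu.-integrable setT (EFin \o (fun x => g x * f x)).
Proof.
move=> mg gM fi.
apply: (le_integrable measurableT _ _ (integrableZl measurableT M fi)).
  apply/measurable_EFinP; apply: measurable_funM => //.
  exact/measurable_EFinP/(measurable_int mu).
move=> x _ /=; rewrite lee_fin !normrM ler_wpM2r// (le_trans (gM x))//.
exact: ler_norm.
Qed.

Lemma Rintegral_dominated_convergence mu (F : (T -> R)^nat) f g :
  (forall n, measurable_fun setT (F n)) ->
  (forall x, F n x @[n --> \oo] --> f x) ->
  mu.-integrable setT (EFin \o g) -> (forall n x, `|F n x| <= g x) ->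
  mu.-integrable setT (EFin \o f) /\
  (\int[mu]_x F n x) @[n --> \oo] --> \int[mu]_x f x.
Proof.
move=> mF Ff gi Fg.
have mF' n : measurable_fun setT (EFin \o F n) by exact/measurable_EFinP.
have Ff' x : (EFin \o F n) x @[n --> \oo] --> (EFin \o f) x.
  by apply: cvg_EFin; [exact: nearW|exact: Ff].
have mf : measurable_fun setT f by apply: (measurable_fun_cvg mF) => x _; exact: Ff.
have [||//|fi _ h] := @dominated_convergence _ _ _ mu _ measurableT
    (fun n => EFin \o F n) (EFin \o f) (EFin \o g) mF' _ _ gi.
- exact/measurable_EFinP.
- by apply: aeW => x _; exact: Ff'.
- by apply: aeW => x n _; rewrite lee_fin; exact: Fg.
split => //; apply: fine_cvg; rewrite fineK//.
by rewrite integrable_fin_num.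
Qed.

(** Both integrals are limits of those of simple functions, for which the equality is
the hypothesis. *)
Lemma Rintegral_same_charge mu nu f g h (M : R) :
  mu.-integrable setT (EFin \o f) -> nu.-integrable setT (EFin \o g) ->
  (forall A, measurable A -> \int[mu]_(x in A) f x = \int[nu]_(x in A) g x) ->
  measurable_fun setT h -> (forall x, `|h x| <= M) ->
  \int[mu]_x (h x * f x) = \int[nu]_x (h x * g x).
Proof.
move=> fi gi fg mh hM.
pose P k := [/\ mu.-integrable setT (EFin \o (fun x => k x * f x)),
  nu.-integrable setT (EFin \o (fun x => k x * g x)) &
  \int[mu]_x (k x * f x) = \int[nu]_x (k x * g x)].
have P1 A : measurable A -> P \1_A.
  move=> mA; have m1 := @measurable_indic _ _ R _ A mA.
  have b1 x : `|\1_A x : R| <= 1 by rewrite ger0_norm// ?indic_le1.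
  split; [exact: integrable_bounded_mul b1 _ ..|].
  rewrite (@eq_Rintegral _ _ _ mu _ (f \_ A)); last first.
    by move=> x _; rewrite patch_indic /= mulrC.
  rewrite (@eq_Rintegral _ _ _ nu _ (g \_ A)); last first.
    by move=> x _; rewrite patch_indic /= mulrC.
  by rewrite -!Rintegral_mkcond fg.
have PD a k l : P k -> P l -> P (fun x => a * k x + l x).
  move=> [k1 k2 k3] [l1 l2 l3].
  have E : (fun x => (a * k x + l x) * f x) = (fun x => a * (k x * f x) + l x * f x).
    by apply/funext => x; rewrite mulrDl mulrA.
  have E' : (fun x => (a * k x + l x) * g x) = (fun x => a * (k x * g x) + l x * g x).
    by apply/funext => x; rewrite mulrDl mulrA.
  rewrite /P E E'; split.
  - exact: (integrableD measurableT (integrableZl measurableT a k1) l1).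
  - exact: (integrableD measurableT (integrableZl measurableT a k2) l2).
  - rewrite !RintegralD// ?RintegralZl ?k3 ?l3//.
    + exact: (integrableZl measurableT a k2).
    + exact: (integrableZl measurableT a k1).
have [k [Pk mk kh kb]] := measurable_fun_approx P1 PD mh.
have lim (la : {measure set T -> \bar R}) l : la.-integrable setT (EFin \o l) ->
    \int[la]_x (k n x * l x) @[n --> \oo] --> \int[la]_x (h x * l x).
  move=> li; have ml : measurable_fun setT l by apply/measurable_EFinP/(measurable_int la).
  apply: (Rintegral_dominated_convergence (g := fun x => M * `|l x|) _ _ _ _).2.
  - by move=> n; exact: measurable_funM.
  - by move=> x; apply: cvgM => //; exact: cvg_cst.
  - exact: (integrableZl measurableT M (integrable_norm li)).
  - by move=> n x; rewrite normrM ler_wpM2r// (le_trans (kb n x)).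
have h1 := lim _ _ fi; have := lim _ _ gi.
under eq_fun do rewrite -(let: And3 _ _ e := Pk _ in e).
move=> h2; exact: (cvg_unique _ h1 h2).
Qed.

End real_integrals.

(** * Vector measures with a density *)

Section row_vectors.
Context {R : realType} {n : nat}.
Implicit Types u v : 'rV[R]_n.

Lemma cvg_row (u : nat -> 'rV[R]_n) v :
  (forall i, u k 0 i @[k --> \oo] --> v 0 i) -> u k @[k --> \oo] --> v.
Proof.
move=> h; rewrite [v]row_sum_delta.
under eq_fun do rewrite (row_sum_delta (u _)).
apply: cvg_big => [|i _]; first exact: add_continuous.
by apply: cvgZr_tmp; exact: h.
Qed.

Lemma dotvC u v : dotv u v = dotv v u.
Proof. by apply: eq_bigr => i _; rewrite mulrC. Qed.

Lemma dotvDl u v w : dotv (u + v) w = dotv u w + dotv v w.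
Proof. by rewrite -big_split; apply: eq_bigr => i _; rewrite mxE mulrDl. Qed.

Lemma dotvZl a u v : dotv (a *: u) v = a * dotv u v.
Proof. by rewrite mulr_sumr; apply: eq_bigr => i _; rewrite mxE mulrA. Qed.

Lemma enormN u : enorm (- u) = enorm u.
Proof. by rewrite -scaleN1r enormZ normrN1 mul1r. Qed.

Lemma dotvDr u v w : dotv u (v + w) = dotv u v + dotv u w.
Proof. by rewrite dotvC dotvDl ![dotv _ u]dotvC. Qed.

Lemma dotv0l v : dotv 0 v = 0.
Proof. by rewrite /dotv big1// => i _; rewrite mxE mul0r. Qed.

Lemma dotv0r v : dotv v 0 = 0.
Proof. by rewrite dotvC dotv0l. Qed.

Lemma dotv_eq0 v : dotv v v = 0 -> v = 0.
Proof. by move=> v0; apply: enorm_eq0; rewrite /enorm v0 sqrtr0. Qed.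

Lemma normr_dotv_enorm u v : `|dotv u v| <= enorm u * enorm v.
Proof.
rewrite ler_norml dotv_le andbT lerNl -mulN1r -dotvZl scaleN1r -(enormN u).
exact: dotv_le.
Qed.

Lemma ler_enormB u v : enorm u - enorm v <= enorm (u - v).
Proof. by rewrite lerBlDr; have := enormD (u - v) v; rewrite subrK. Qed.

End row_vectors.

Section density.
Context {d : measure_display} {T : measurableType d} {R : realType} {n : nat}.
Implicit Types (mu : {measure set T -> \bar R}) (s : T -> 'rV[R]_n)
  (l : vmeasure T R n).

Definition vintegrable mu s :=
  forall i, mu.-integrable setT (fun x => (s x 0 i)%:E).

Definition has_density mu s l := vintegrable mu s /\
  forall A, measurable A -> forall i, l A 0 i = \int[mu]_(x in A) s x 0 i.

Definition vmeasurable s := forall i, measurable_fun setT (fun x => s x 0 i).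

Lemma vintegrable_measurable mu s : vintegrable mu s -> vmeasurable s.
Proof. by move=> h i; apply/measurable_EFinP; exact: (measurable_int mu (h i)). Qed.

Lemma vmeasurable_dotv s t : vmeasurable s -> vmeasurable t ->
  measurable_fun setT (fun x => dotv (s x) (t x)).
Proof. by move=> ms mt; apply: measurable_sum => i; exact: measurable_funM. Qed.

Lemma vmeasurable_enorm s : vmeasurable s ->
  measurable_fun setT (fun x => enorm (s x)).
Proof.
move=> ms; have msqrt : measurable_fun setT (Num.sqrt : R -> R).
  by apply: continuous_measurable_fun; exact: sqrt_continuous.
exact: (measurableT_comp msqrt (vmeasurable_dotv ms ms)).
Qed.

Lemma vintegrable_enorm mu s : vintegrable mu s ->
  mu.-integrable setT (fun x => (enorm (s x))%:E).
Proof.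
move=> si; have : mu.-integrable setT (fun x => (\sum_i `|(s x 0 i)%:E|)%E).
  by apply: integrable_sum => // i _; exact: integrable_abse.
apply: le_integrable => //.
  by apply/measurable_EFinP/vmeasurable_enorm/vintegrable_measurable/si.
move=> x _; rewrite sumEFin /= lee_fin [leLHS]ger0_norm ?enorm_ge0//.
by apply: le_trans (enorm_le_coord _) (ler_norm _).
Qed.

Lemma vmeasure_eq l l' : (forall A, measurable A -> l A = l' A) -> l = l'.
Proof.
move=> h; apply/val_inj/funext => A /=.
have [mA|mA] := pselect (measurable A); first exact: h.
by rewrite (vmeasureP l).1// (vmeasureP l').1.
Qed.

Lemma has_density_ex mu s : vintegrable mu s -> exists l, has_density mu s l.
Proof.
move=> si.
pose m (A : set T) : 'rV[R]_n :=
  if pselect (measurable A) then \row_i \int[mu]_(x in A) s x 0 i else 0.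
have mE A i : measurable A -> m A 0 i = \int[mu]_(x in A) s x 0 i.
  by move=> mA; rewrite /m; case: pselect => [?|//]; rewrite mxE.
have mP : m \in vmeasure_pred.
  apply/asboolP; split=> [A mA|F mF tF]; first by rewrite /m; case: pselect.
  apply: cvg_row => i; rewrite mE; last exact: bigcup_measurable.
  have := @charge_semi_sigma_additive _ _ _ (induced_charge (si i)) F mF tF
    (bigcup_measurable (fun k _ => mF k)).
  rewrite /induced_charge => h.
  have fin A : measurable A -> (\int[mu]_(x in A) (s x 0 i)%:E)%E \is a fin_num.
    by move=> mA; apply: integrable_fin_num => //; exact: integrableS (si i).
  rewrite (_ : (fun k => _) = fun k =>
      fine (\sum_(0 <= j < k) \int[mu]_(x in F j) (s x 0 i)%:E)%E); last first.
    apply/funext => k; rewrite summxE -sum_fine; last by move=> j _; exact: fin.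
    by apply: eq_bigr => j _; rewrite mE.
  apply: fine_cvg; rewrite fineK//; apply: fin; exact: bigcup_measurable.
by exists (VMeasure mP); split => // A mA i; exact: mE.
Qed.

Lemma has_density_uniq mu s t l l' :
  {ae mu, forall x, s x = t x} -> has_density mu s l -> has_density mu t l' ->
  l = l'.
Proof.
move=> st [si sl] [ti tl]; apply: vmeasure_eq => A mA; apply/rowP => i.
rewrite sl// tl//; congr fine; apply: ae_eq_integral => //.
- by apply: measurable_funTS; exact: (measurable_int mu (si i)).
- by apply: measurable_funTS; exact: (measurable_int mu (ti i)).
- by move: st; apply: filterS => x -> .
Qed.

Lemma vintegrable_lin mu a s t : vintegrable mu s -> vintegrable mu t ->
  vintegrable mu (fun x => a *: s x + t x).
Proof.
move=> si ti i.
have := integrableD measurableT (integrableZl measurableT a (si i)) (ti i).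
by apply: eq_integrable => // x _; rewrite !mxE EFinD EFinM.
Qed.

Lemma has_density_lin mu a s t l k : has_density mu s l -> has_density mu t k ->
  has_density mu (fun x => a *: s x + t x) (a *: l + k).
Proof.
move=> [si sl] [ti tk]; split; first exact: vintegrable_lin.
move=> A mA i; rewrite [(a *: l + k) A](_ : _ = a *: l A + k A)// !mxE sl// tk//.
have siA : mu.-integrable A (EFin \o (fun x => s x 0 i)) by apply: integrableS (si i).
have tiA : mu.-integrable A (EFin \o (fun x => t x 0 i)) by apply: integrableS (ti i).
rewrite -RintegralZl// -RintegralD//; last exact: (integrableZl mA a siA).
by apply: eq_Rintegral => x _; rewrite !mxE.
Qed.

Lemma radon_nikodym_density (mu : {finite_measure set T -> \bar R}) l :
  (forall A, measurable A -> mu A = 0%E -> l A = 0) ->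
  exists s, has_density mu s l.
Proof.
move=> lmu.
have dom i : vcoord l i `<< mu.
  apply/null_content_dominatesP => A mA A0.
  by rewrite /vcoord lmu ?mxE.
exists (fun x => \row_i fine (Radon_Nikodym (vcoord l i) mu x)).
have E i : (fun x => ((\row_i fine (Radon_Nikodym (vcoord l i) mu x)) 0 i)%:E) =
    Radon_Nikodym (vcoord l i) mu.
  by apply/funext => x; rewrite mxE fineK//; exact: (Radon_Nikodym_fin_num _ (dom i)).
split=> [i|A mA i]; first by rewrite E; exact: (Radon_Nikodym_integrable (dom i)).
by rewrite /Rintegral E -(Radon_Nikodym_integral (dom i)).
Qed.

Lemma polar_density l : has_density (tvar l) (polar l) l.
Proof.
have E i : (fun x => (polar l x 0 i)%:E) = Radon_Nikodym (vcoord l i) (tvar l).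
  apply/funext => x; rewrite mxE fineK// Radon_Nikodym_fin_num//.
  exact: vcoord_dominated.
split=> [i|A mA i]; first by rewrite E; apply: Radon_Nikodym_integrable; exact: vcoord_dominated.
by rewrite /Rintegral E -Radon_Nikodym_integral//; exact: vcoord_dominated.
Qed.

End density.

Section total_variation_density.
Context {d : measure_display} {T : measurableType d} {R : realType} {n : nat}.
Implicit Types (s : T -> 'rV[R]_n) (l : vmeasure T R n).
Local Open Scope ereal_scope.

Lemma has_density_dotv (mu : {measure set T -> \bar R}) s l (v : 'rV[R]_n) A :
  has_density mu s l -> measurable A ->
  dotv v (l A) = (\int[mu]_(x in A) dotv v (s x))%R.
Proof.
move=> [si sl] mA.
have siA i : mu.-integrable A (fun x => (s x 0%R i)%:E) by apply: integrableS (si i).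
rewrite /Rintegral /dotv (_ : (fun x => _) =
    fun x => \sum_i (v 0%R i)%:E * (s x 0%R i)%:E); last first.
  by apply/funext => x; rewrite -sumEFin.
rewrite integral_sum//; last first.
  by move=> i; exact: (integrableZl mA (v 0%R i) (siA i)).
rewrite (eq_bigr (fun i => (v 0%R i)%:E * \int[mu]_(x in A) (s x 0%R i)%:E));
  last by move=> i _; exact: (integralZl mA (siA i)).
rewrite -sum_fine; last first.
  by move=> i _; rewrite fin_numM// integrable_fin_num.
by apply: eq_bigr => i _; rewrite fineM// ?integrable_fin_num// sl.
Qed.

Lemma enorm_has_density (mu : {measure set T -> \bar R}) s l A :
  has_density mu s l -> measurable A ->
  (enorm (l A))%:E <= \int[mu]_(x in A) (enorm (s x))%:E.
Proof.
move=> sl mA; have [si _] := sl.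
have ei : mu.-integrable A (fun x => (enorm (s x))%:E).
  by apply: integrableS (vintegrable_enorm si).
rewrite -(fineK (integrable_fin_num mA ei)) lee_fin.
have [l0|l0] := eqVneq (enorm (l A)) 0%R.
  by rewrite l0; apply: Rintegral_ge0 => x _; exact: enorm_ge0.
have lp : (0 < enorm (l A))%R by rewrite lt_neqAle eq_sym l0 enorm_ge0.
rewrite -(ler_pM2l lp) -expr2 enorm_sqr (has_density_dotv _ sl)//.
have di : mu.-integrable A (EFin \o (fun x => dotv (l A) (s x))).
  apply: (le_integrable mA _ _ (integrableZl mA (enorm (l A)) ei)).
    apply/measurable_EFinP; apply: measurable_funTS.
    apply: vmeasurable_dotv; last exact: vintegrable_measurable si.
    by move=> i; exact: measurable_cst.
  move=> x _ /=; rewrite lee_fin [leRHS]ger0_norm ?mulr_ge0 ?enorm_ge0//.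
  exact: normr_dotv_enorm.
rewrite -RintegralZl//; apply: le_Rintegral => //.
  exact: (integrableZl mA (enorm (l A)) ei).
by move=> x _; exact: dotv_le.
Qed.

Lemma tvar_ext l (k : vmeasure T R n) A : (forall B, measurable B -> B `<=` A -> l B = k B) ->
  tvar l A = tvar k A.
Proof.
have le (l' k' : vmeasure T R n) :
    (forall B, measurable B -> B `<=` A -> l' B = k' B) -> tvar l' A <= tvar k' A.
  move=> lk; apply: ge_ereal_sup => _ [j [F [mF tF FA ->]]].
  apply: ereal_sup_ubound; exists j, F; split => //.
  by apply: eq_bigr => i _; rewrite lk// => x Fx; apply: FA; exists i.
by move=> h; apply/eqP; rewrite eq_le !le// => B mB BA; rewrite h.
Qed.

Section tvar_density.
Variables (mu : {finite_measure set T -> \bar R}) (s : T -> 'rV[R]_n)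
  (l : vmeasure T R n).
Hypothesis sl : has_density mu s l.

Let mes A : measurable A -> measurable_fun A (fun x => (enorm (s x))%:E).
Proof.
move=> mA; apply/measurable_EFinP; apply: measurable_funTS.
exact: vmeasurable_enorm (vintegrable_measurable sl.1).
Qed.

Let tvar_le_density A : measurable A ->
  tvar l A <= \int[mu]_(x in A) (enorm (s x))%:E.
Proof.
move=> mA; apply: ge_ereal_sup => _ [j [F [mF tF FA ->]]].
have FA' : \big[setU/set0]_(i < j) F i `<=` A.
  by apply: subset_trans FA; exact: bigsetU_bigcup.
apply: (@le_trans _ _ (\int[mu]_(x in \big[setU/set0]_(i < j) F i) (enorm (s x))%:E)).
  rewrite -(big_mkord xpredT F) ge0_integral_bigsetU//.
  - by rewrite big_mkord; apply: lee_sum => i _; exact: (enorm_has_density sl).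
  - exact: iota_uniq.
  - exact: sub_trivIset tF.
  - by apply: mes; apply: bigsetU_measurable.
  - by move=> x _; rewrite lee_fin enorm_ge0.
apply: ge0_subset_integral => //; first exact: bigsetU_measurable.
- exact: mes.
- by move=> x _; rewrite lee_fin enorm_ge0.
Qed.

(** For a constant density the norm of the integral is the integral of the norm, and
replacing [s] by one of its values costs [n * e] on either side. *)
Let integral_enorm_small_osc (e : R) A : (0 <= e)%R -> measurable A ->
  (forall x y, A x -> A y -> forall i, `|s x 0%R i - s y 0%R i| <= e)%R ->
  \int[mu]_(x in A) (enorm (s x))%:E <=
    (enorm (l A))%:E + (n%:R * e *+ 2)%:E * mu A.
Proof.
move=> e0 mA osc.
have [->|/set0P[x0 Ax0]] := eqVneq A set0.
  by rewrite integral_set0 measure0 mule0 adde0 lee_fin enorm_ge0.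
have enorm_le x : A x -> (enorm (s x - s x0) <= n%:R * e)%R.
  move=> Ax; apply: le_trans (enorm_le_coord _) _.
  apply: (@le_trans _ _ (\sum_(i < n) e)%R).
    by apply: ler_sum => i _; rewrite !mxE; exact: osc.
  by rewrite sumr_const card_ord mulr_natl.
pose w : R := fine (mu A).
have wE : mu A = w%:E by rewrite fineK// fin_num_measure.
have w0 : (0 <= w)%R by rewrite fine_ge0.
have h1 : \int[mu]_(x in A) (enorm (s x))%:E <= (enorm (s x0) + n%:R * e)%:E * mu A.
  rewrite -integral_cst//; apply: ge0_le_integral => //.
  - by move=> x _; rewrite lee_fin enorm_ge0.
  - exact: mes.
  - move=> x Ax; rewrite lee_fin -lerBlDl (le_trans _ (enorm_le _ Ax))//.
    exact: ler_enormB.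
have [k kE] : exists k : vmeasure T R n, has_density mu (fun=> s x0) k.
  apply: has_density_ex => i; exact: finite_measure_integrable_cst.
have kA : k A = w *: s x0.
  apply/rowP => i; rewrite kE.2// Rintegral_cst// mxE.
  by rewrite mulrC.
have h2 := enorm_has_density (has_density_lin (-1) kE sl) mA.
have h3 : (enorm ((-1 *: k + l)%R A))%:E <= (n%:R * e)%:E * mu A.
  apply: le_trans h2 _; rewrite -integral_cst//; apply: ge0_le_integral => //.
  - by move=> x _; rewrite lee_fin enorm_ge0.
  - apply/measurable_EFinP; apply: measurable_funTS; apply: vmeasurable_enorm.
    exact: (vintegrable_measurable (has_density_lin (-1) kE sl).1).
  - by move=> x Ax; rewrite lee_fin scaleN1r addrC enorm_le.
apply: le_trans h1 _; rewrite wE -!EFinM -EFinD lee_fin.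
move: h3; rewrite wE -EFinM lee_fin.
rewrite [((-1 *: k + l)%R A)](_ : _ = l A - w *: s x0)%R; last first.
  by rewrite -kA -[in RHS]scaleN1r [RHS]addrC.
have := ler_enormB (w *: s x0) (l A); rewrite -(enormN (_ - _)) opprB enormZ ger0_norm//.
by move=> h4 h5; nra.
Qed.

Let density_le_tvar A (e : R) : (0 < e)%R -> measurable A ->
  \int[mu]_(x in A) (enorm (s x))%:E <= tvar l A + (n%:R * e *+ 2)%:E * mu A.
Proof.
move=> e0 mA.
(* cut [A] along the cells of the grid of mesh [e] *)
pose z x : 'rV[int]_n := \row_i Num.floor (s x 0%R i / e).
pose F k := A `&` [set x | pickle (z x) = k].
have ms i : measurable_fun setT (fun x => s x 0%R i / e)%R.
  by apply: measurable_funM => //; exact: vintegrable_measurable sl.1 i.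
have mF k : measurable (F k).
  apply: measurableI => //.
  have [[y yk]|no] := pselect (exists y : 'rV[int]_n, pickle y = k); last first.
    rewrite (_ : [set _ | _] = set0)//; apply/seteqP; split => // x xk.
    by apply: no; exists (z x).
  rewrite (_ : [set _ | _] = \bigcap_(i in [set: 'I_n])
      ((fun x => s x 0%R i / e)%R @^-1` `[(y 0%R i)%:~R%R, (y 0%R i + 1)%:~R%R[%classic)).
    apply: fin_bigcap_measurable => // i _.
    by rewrite -[X in measurable X]setTI; exact: ms.
  apply/seteqP; split=> [x /= xk i _|x xi] /=.
    have <- : z x = y by apply: (pcan_inj pickleK); rewrite xk.
    by rewrite mxE in_itv/=; exact: floor_itv.
  rewrite -yk; congr pickle; apply/rowP => i; rewrite mxE.
  by apply: floor_def; have := xi i Logic.I; rewrite /= in_itv.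
have tF : trivIset setT F.
  by apply/trivIsetP => i j _ _ ij; rewrite -subset0 => x [[_ /= xi] [_ /= xj]];
     move: ij; rewrite -xi -xj eqxx.
have AE : A = \bigcup_k F k.
  by apply/seteqP; split=> [x Ax|x [k _ []]//]; exists (pickle (z x)).
have osc k x y : F k x -> F k y -> forall i, (`|s x 0 i - s y 0 i| <= e)%R.
  move=> [_ /= xk] [_ /= yk] i.
  have : z x = z y by apply: (pcan_inj pickleK); rewrite xk yk.
  move=> /rowP/(_ i); rewrite !mxE => zxy.
  have /andP[x1 x2] := floor_itv (s x 0%R i / e).
  have /andP[y1 y2] := floor_itv (s y 0%R i / e).
  move: x1 x2 y1 y2; rewrite zxy intrD ler_pdivlMr// ltr_pdivrMr// ler_pdivlMr// ltr_pdivrMr//.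
  by move=> x1 x2 y1 y2; rewrite ler_norml; apply/andP; split; nra.
have c0 : (0 <= n%:R * e *+ 2)%R by rewrite mulrn_wge0// mulr_ge0// ltW.
rewrite {1}AE ge0_integral_bigcup//; last 2 first.
- by rewrite -AE; exact: mes.
- by move=> x _; rewrite lee_fin enorm_ge0.
have sE (m : {measure set T -> \bar R}) : m A = \sum_(k <oo) m (F k).
  by rewrite [in LHS]AE measure_semi_bigcup// -AE.
rewrite (sE (tvar l)) (sE mu).
rewrite -nneseriesZl// -nneseriesD//; last by move=> i _ _; rewrite mule_ge0.
apply: lee_nneseries => [i _ _|i _].
  by apply: integral_ge0 => x _; rewrite lee_fin enorm_ge0.
apply: le_trans (integral_enorm_small_osc (ltW e0) (mF i) (@osc i)) _.
by rewrite leeD2r// enorm_le_tvar.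
Qed.

(** The upper bound is the triangle inequality.  For the lower bound, cut the space
into countably many cells on which [s] is almost constant: there is almost no
cancellation inside a cell. *)
Lemma tvar_density A : measurable A ->
  tvar l A = \int[mu]_(x in A) (enorm (s x))%:E.
Proof.
move=> mA; apply/eqP; rewrite eq_le tvar_le_density//=.
have tf : tvar l A \is a fin_num by rewrite fin_num_measure.
have mf : mu A \is a fin_num by rewrite fin_num_measure.
apply/lee_addgt0Pr => e e0.
pose c : R := (n%:R * fine (mu A) *+ 2 + 1)%R.
have c0 : (0 < c)%R.
  by rewrite ltr_wpDl// mulrn_wge0// mulr_ge0// fine_ge0.
apply: le_trans (density_le_tvar (divr_gt0 e0 c0) mA) _.
rewrite leeD2l// -(fineK mf) -EFinM lee_fin.
rewrite [leLHS](_ : _ = (e : R) / c * (n%:R * fine (mu A) *+ 2))%R; last by ring.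
by rewrite -mulrA ler_piMr ?ltW// mulrC ltr_pdivrMr// mul1r /c ltrDl.
Qed.

End tvar_density.
End total_variation_density.

(** * Smooth functions and test functions *)

Section smooth_functions.
Context {R : realType} {d : nat}.
Local Notation Rd := 'rV[R]_d.
Implicit Types f g : Rd -> R.

Lemma smooth_continuous f : smooth f -> continuous f.
Proof. by move=> /(_ [::]) []. Qed.

Lemma smooth_derivable f x i : smooth f -> derivable f x (delta_mx 0 i).
Proof. by move=> /(_ [::]) [_]; exact. Qed.

Lemma smooth_partial f i : smooth f -> smooth (partial i f).
Proof. by move=> sf s; have := sf (rcons s i); rewrite /partials foldr_rcons. Qed.

(** Coinduction, in place of inductions on multi-indices: smoothness is the largest
property that implies continuity and the existence of the partial derivatives and that
passes to them. *)
Lemma smooth_coind (P : (Rd -> R) -> Prop) :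
  (forall f, P f -> continuous f) ->
  (forall f x i, P f -> derivable f x (delta_mx 0 i)) ->
  (forall f i, P f -> P (partial i f)) ->
  forall f, P f -> smooth f.
Proof.
move=> Pc Pd Pp f Pf s.
have Ps : P (partials s f) by elim: s => //= i s; exact: Pp.
by split=> [|i x]; [exact: Pc|exact: Pd].
Qed.

Lemma partial_lin i a f g x : smooth f -> smooth g ->
  partial i (a *: f + g) x = a * partial i f x + partial i g x.
Proof.
move=> sf sg; have df : derivable f x (delta_mx 0 i) by exact: smooth_derivable.
have dg : derivable g x (delta_mx 0 i) by exact: smooth_derivable.
by rewrite /partial (deriveD (derivableZ df) dg) (deriveZ a df).
Qed.

Lemma partialM i f g x : smooth f -> smooth g ->
  partial i (f * g) x = f x * partial i g x + g x * partial i f x.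
Proof. by move=> sf sg; rewrite /partial deriveM//; exact: smooth_derivable. Qed.

Lemma smooth_lin a f g : smooth f -> smooth g -> smooth (a *: f + g).
Proof.
move=> sf sg.
apply: (@smooth_coind (fun h => exists f g, [/\ smooth f, smooth g & h = a *: f + g]));
  last by exists f, g.
- move=> _ [{}f [{}g [{}sf {}sg ->]]] x.
  have cf : f y @[y --> x] --> f x by exact: smooth_continuous sf x.
  have cg : g y @[y --> x] --> g x by exact: smooth_continuous sg x.
  exact: (cvgD (cvgM (cvg_cst a) cf) cg).
- move=> _ x i [{}f [{}g [{}sf {}sg ->]]].
  by apply: derivableD; [apply: derivableZ|]; exact: smooth_derivable.
- move=> _ i [{}f [{}g [{}sf {}sg ->]]]; exists (partial i f), (partial i g).
  split; [exact: smooth_partial..|].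
  by apply/funext => x; rewrite partial_lin.
Qed.

(** Partial derivatives of a product are only sums of products. *)
Inductive product_span : (Rd -> R) -> Prop :=
| product_span_mul f g of smooth f & smooth g : product_span (f * g)
| product_span_add f g of product_span f & product_span g : product_span (f + g).

Lemma smoothM f g : smooth f -> smooth g -> smooth (f * g).
Proof.
move=> sf sg; apply: (@smooth_coind product_span); last exact: product_span_mul.
- move=> h; elim=> [f1 g1 sf1 sg1|f1 g1 _ cf _ cg] x.
    have cf : f1 y @[y --> x] --> f1 x by exact: smooth_continuous sf1 x.
    have cg : g1 y @[y --> x] --> g1 x by exact: smooth_continuous sg1 x.
    exact: (cvgM cf cg).
  exact: (cvgD (cf x) (cg x)).
- move=> h x i; elim=> [f1 g1 sf1 sg1|f1 g1 _ cf _ cg].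
    by apply: derivableM; exact: smooth_derivable.
  exact: derivableD.
- move=> h i H.
  have [//] : product_span (partial i h) /\ forall x, derivable h x (delta_mx 0 i).
  elim: H => [f1 g1 sf1 sg1|f1 g1 _ [pf df] _ [pg dg]]; split.
  + rewrite (_ : partial i _ = f1 * partial i g1 + g1 * partial i f1); last first.
      by apply/funext => x; rewrite partialM.
    exact: (product_span_add (product_span_mul sf1 (smooth_partial i sg1))
      (product_span_mul sg1 (smooth_partial i sf1))).
  + by move=> x; apply: derivableM; exact: smooth_derivable.
  + rewrite (_ : partial i _ = partial i f1 + partial i g1).
      exact: product_span_add.
    by apply/funext => x; rewrite /partial deriveD.
  + by move=> x; exact: derivableD.
Qed.

Lemma smooth_cst (c : R) : smooth (cst c : Rd -> R).
Proof.
apply: (@smooth_coind (fun h => exists c : R, h = cst c)); last by exists c.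
- by move=> _ [b ->]; exact: cst_continuous.
- by move=> _ x i [b ->]; exact: derivable_cst.
- by move=> _ i [b ->]; exists 0; apply/funext => x; rewrite /partial derive_cst.
Qed.

Lemma subset_tsupport f x : f x != 0 -> tsupport f x.
Proof. by move=> fx; exact: subset_closure. Qed.

Lemma compact_tsupport_sub f (A : set Rd) : compact A -> closed A ->
  (forall x, f x != 0 -> A x) -> compact (tsupport f).
Proof.
move=> cA clA fA; apply: (subclosed_compact _ cA); first exact: closed_closure.
by rewrite ((closure_id A).1 clA); exact: closure_subset.
Qed.

Lemma test_functionMl f g : test_function f -> smooth g -> test_function (f * g).
Proof.
move=> [sf cf] sg; split; first exact: smoothM.
apply: (compact_tsupport_sub cf); first exact: closed_closure.
by move=> x; rewrite mulf_eq0 negb_or => /andP[fx _]; exact: subset_tsupport.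
Qed.

Lemma test_function_lin a f g : test_function f -> test_function g ->
  test_function (a *: f + g).
Proof.
move=> [sf cf] [sg cg]; split; first exact: smooth_lin.
apply: (compact_tsupport_sub (compactU cf cg)).
  by apply: closedU; exact: closed_closure.
move=> x fgx; have [f0|f0] := eqVneq (f x) 0; last by left; exact: subset_tsupport.
right; apply: subset_tsupport; apply: contraNneq fgx => g0; apply/eqP.
by rewrite [LHS](_ : _ = a * f x + g x)// f0 g0 mulr0 addr0.
Qed.

Lemma partial_tsupport i f x : partial i f x != 0 -> tsupport f x.
Proof.
apply: contra_neqP => fx.
have nx : \forall y \near x, f y = (cst 0 : Rd -> R) y.
  have : nbhs x (~` tsupport f).
    by apply: open_nbhs_nbhs; split => //; apply: closed_openC; exact: closed_closure.
  apply: filterS => y fy; apply/eqP; apply: contra_notT fy; exact: subset_tsupport.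
by rewrite /partial (near_eq_derive _ nx) derive_cst.
Qed.

Lemma test_function_partial i f : test_function f -> test_function (partial i f).
Proof.
move=> [sf cf]; split; first exact: smooth_partial.
apply: (compact_tsupport_sub cf); first exact: closed_closure.
by move=> x /partial_tsupport.
Qed.

Lemma test_function_bounded f : test_function f -> exists M, forall x, `|f x| <= M.
Proof.
move=> [sf cf].
have : compact [set f x | x in tsupport f].
  by apply: continuous_compact => //; apply: continuous_subspaceT; exact: smooth_continuous.
move=> /compact_bounded[M [_ hM]]; exists (Num.max 0 (M + 1)) => x.
have [->|fx] := eqVneq (f x) 0; first by rewrite normr0 le_max lexx.
rewrite le_max; apply/orP; right; apply: (hM (M + 1)); first by rewrite ltrDl.
by exists x => //; exact: subset_tsupport.
Qed.

(** Join two points by a path parallel to the axes and use the mean value theorem on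
each edge. *)
Lemma lipschitz_of_partials f (L : R) : smooth f ->
  (forall i x, `|partial i f x| <= L) ->
  forall x y, `|f x - f y| <= L * \sum_i `|x 0 i - y 0 i|.
Proof.
move=> sf fL x y.
have edge i (c : R) z : 0 <= c -> `|f (z + c *: delta_mx 0 i) - f z| <= L * c.
  move=> c0; pose h (t : R) := f (z + t *: delta_mx 0 i).
  have hd (t : R) : is_derive t (1 : R) h (partial i f (z + t *: delta_mx 0 i)).
    have E : (fun u : R => u^-1 *: ((h \o shift t) (u *: 1) - h t)) =
      (fun u : R => u^-1 *: ((f \o shift (z + t *: delta_mx 0 i)) (u *: delta_mx 0 i) -
         f (z + t *: delta_mx 0 i))).
      apply/funext => u; rewrite /h /= -[u *: 1]/(u * 1) mulr1; congr (_ *: (f _ - _)).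
      by rewrite scalerDl addrCA.
    apply: DeriveDef; first by rewrite /derivable E; exact: smooth_derivable.
    by rewrite /partial /derive E.
  have hc : {within `[0, c], continuous h}.
    by apply: derivable_within_continuous => t _; exact: (@ex_derive _ _ _ _ _ _ _ (hd t)).
  have [t _] := MVT_segment c0 (fun t _ => hd t) hc.
  rewrite {1 2}/h scale0r addr0 subr0 => ->.
  by rewrite normrM (ger0_norm c0) ler_wpM2r.
have edge' i (c : R) z : `|f (z + c *: delta_mx 0 i) - f z| <= L * `|c|.
  have [c0|c0] := leP 0 c; first by rewrite (ger0_norm c0) edge.
  have := edge i (- c) (z + c *: delta_mx 0 i).
  rewrite scaleNr addrK distrC (ltr0_norm c0); apply.
  by rewrite oppr_ge0 ltW.
have path (s : seq 'I_d) (c : Rd) z :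
    `|f (z + \sum_(i <- s) c 0 i *: delta_mx 0 i) - f z| <= L * \sum_(i <- s) `|c 0 i|.
  elim: s z => [|i s ih] z; first by rewrite !big_nil addr0 subrr normr0 mulr0.
  rewrite !big_cons addrA -(subrKA (f (z + c 0 i *: delta_mx 0 i))) mulrDr.
  by rewrite (le_trans (ler_normD _ _))// [leRHS]addrC lerD.
have := path (index_enum _) (x - y) y.
rewrite -(row_sum_delta (x - y)) [y + _]addrC subrK => /le_trans; apply.
by rewrite le_eqVlt; apply/orP; left; apply/eqP; congr (_ * _); apply: eq_bigr => i _; rewrite !mxE.
Qed.

End smooth_functions.

(** * Bump functions on boxes *)

Section flat_exponential.
Context {R : realType}.
Implicit Types (p : {poly R}) (t : R).

(** The derivatives of [exp (- 1 / t)], extended by 0 to negative [t], all have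
this form. *)
Definition flat_exp p t : R :=
  if 0 < t then p.[t^-1] * expR (- t^-1) else 0.

Let expX_le n t : 0 < t -> t^-1 ^+ n * expR (- t^-1) <= n.+1`!%:R * t.
Proof.
move=> t0; set y := t^-1; have y0 : 0 < y by rewrite invr_gt0.
have f0 : 0 < n.+1`!%:R :> R by rewrite ltr0n fact_gt0.
have h : y ^+ n.+1 / n.+1`!%:R <= expR y.
  by apply: le_trans (expR_ge1Dxn n (ltW y0)); rewrite lerDr.
rewrite expRN ler_pdivrMr ?expR_gt0//.
have -> : t = y^-1 by rewrite invrK.
rewrite mulrAC ler_pdivlMr// -exprSr.
by move: h; rewrite ler_pdivrMr// mulrC.
Qed.

Let horner_exp_le p n : exists C, forall t, 0 < t ->
  `|p.[t^-1]| * t^-1 ^+ n * expR (- t^-1) <= C * t.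
Proof.
elim/poly_ind: p n => [|p c ih] n.
  by exists 0 => t t0; rewrite horner0 normr0 !mul0r.
have [C hC] := ih n.+1; exists (C + `|c| * n.+1`!%:R) => t t0.
rewrite hornerD hornerM hornerX hornerC mulrDl.
have y0 : 0 < t^-1 by rewrite invr_gt0.
apply: (@le_trans _ _ (`|p.[t^-1]| * t^-1 ^+ n.+1 * expR (- t^-1) +
    `|c| * (t^-1 ^+ n * expR (- t^-1)))).
  rewrite mulrA -mulrDl ler_wpM2r ?expR_ge0// exprS mulrA -mulrDl.
  rewrite ler_wpM2r//; first by rewrite exprn_ge0// ltW.
  by rewrite (le_trans (ler_normD _ _))// normrM (gtr0_norm y0).
by apply: lerD; [exact: hC|rewrite -mulrA ler_wpM2l// expX_le].
Qed.

(** The decay at 0 that makes every derivative vanish there. *)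
Lemma flat_exp_le p : exists C, forall t, `|flat_exp p t| <= C * `|t|.
Proof.
have [C hC] := horner_exp_le p 0.
exists (`|C|) => t; rewrite /flat_exp; case: ifPn => t0.
  have := hC t t0; rewrite expr0 mulr1 normrM (ger0_norm (expR_ge0 _)) (gtr0_norm t0).
  by move=> /le_trans; apply; rewrite ler_wpM2r ?ler_norm// ltW.
by rewrite normr0 mulr_ge0.
Qed.

Lemma is_derive_flat_exp p t :
  is_derive t (1 : R) (flat_exp p) (flat_exp ('X^2 * (p - p^`())) t).
Proof.
have [t0|t0|->] := ltrgtP t 0.
- have nt : \near t, (cst 0 : R -> R) t = flat_exp p t.
    near=> u; rewrite /flat_exp ifF//; apply/negbTE; rewrite -leNgt ltW//.
    near: u; exact: lt_nbhsl.
  apply: (near_eq_is_derive nt); apply: is_derive_eq.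
  by rewrite /flat_exp ifF//; apply/negbTE; rewrite -leNgt ltW.
- have nt : \near t, (fun u => p.[u^-1] * expR (- u^-1)) t = flat_exp p t.
    near=> u; rewrite /flat_exp ifT//.
    near: u; exact: lt_nbhsr.
  apply: (near_eq_is_derive nt).
  have tn0 : t != 0 by rewrite gt_eqF.
  have di : is_derive t (1 : R) (fun u : R => u^-1) (- t ^- 2 *: 1).
    exact: (@is_deriveV _ id).
  have dp := is_derive1_comp (is_derive_poly p t^-1) di.
  have dm : is_derive t (1 : R) (fun u : R => - u^-1) (- (- t ^- 2 *: 1)).
    exact: is_deriveN.
  have de := @is_derive1_comp _ expR (fun u => - u^-1) t _ _ (is_derive_expR _) dm.
  apply: (is_derive_eq (is_deriveM dp de)).
  rewrite /flat_exp t0 hornerM hornerXn hornerD hornerN /=.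
  rewrite -![_ *: _]/(_ * _) exprVn; ring.
- have [C hC] := flat_exp_le ('X * p).
  have E (u : R) : u^-1 *: ((flat_exp p \o shift 0) (u *: 1) - flat_exp p 0) =
      flat_exp ('X * p) u.
    rewrite /= addr0 -[u *: 1]/(u * 1) mulr1 /flat_exp ltxx subr0.
    case: ifPn => u0; last by rewrite scaler0.
    by rewrite hornerM hornerX -mulrA.
  have lim0 : u^-1 *: ((flat_exp p \o shift 0) (u *: 1) - flat_exp p 0) @[u --> 0^'] --> 0.
    under eq_fun do rewrite E.
    apply: norm_cvg0.
    apply: (@squeeze_cvgr _ _ _ _ (cst 0) (fun u => C * `|u|)).
    + by near=> u; rewrite normr_ge0 hC.
    + exact: cvg_cst.
    + have u0 : u @[u --> (0 : R)^'] --> (0 : R) by exact: cvg_within.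
      have := cvgM (cvg_cst C) (cvg_norm u0).
      by rewrite normr0 mulr0; apply; exact: dnbhs_filter.
  apply: DeriveDef; first by apply/cvg_ex; exists 0.
  by rewrite /derive (cvg_lim _ lim0)// /flat_exp ltxx.
Unshelve. all: by end_near. Qed.

Lemma flat_exp_continuous p : continuous (flat_exp p).
Proof.
move=> t; apply: differentiable_continuous; apply/derivable1_diffP.
exact: (@ex_derive _ _ _ _ _ _ _ (is_derive_flat_exp p t)).
Qed.

Lemma flat_exp1_itv t : 0 <= flat_exp 1 t <= 1.
Proof.
rewrite /flat_exp; case: ifPn => t0; last by rewrite lexx ler01.
by rewrite hornerC mul1r expR_ge0 -expR0 ler_expR oppr_le0 invr_ge0 ltW.
Qed.

Lemma cvg_flat_exp1 t :
  flat_exp 1 (k.+1%:R * t) @[k --> \oo] --> (if 0 < t then 1 else 0 : R).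
Proof.
have [t0|t0] := ltP 0 t; last first.
  under eq_fun do rewrite /flat_exp pmulr_rgt0// ltNge t0 /=; exact: cvg_cst.
under eq_fun do rewrite /flat_exp pmulr_rgt0// t0 hornerC mul1r invfM.
have h : - (@harmonic R k * t^-1) @[k --> \oo] --> - (0 * t^-1).
  by apply: cvgN; apply: cvgM; [exact: cvg_harmonic|exact: cvg_cst].
have : expR (- (@harmonic R k * t^-1)) @[k --> \oo] --> expR (- (0 * t^-1)).
  by apply: (continuous_cvg _ _ h); exact: continuous_expR.
by rewrite mul0r oppr0 expR0.
Qed.
End flat_exponential.

Section bumps.
Context {R : realType} {d : nat}.
Local Notation Rd := 'rV[R]_d.

Lemma is_derive_coord (q : R -> R) (x : Rd) i j (l : R) :
  is_derive (x 0 i) (1 : R) q l ->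
  is_derive x (delta_mx 0 j : Rd) (fun y => q (y 0 i)) (if i == j then l else 0).
Proof.
move=> [dq lq].
have E : (fun h : R => h^-1 *: (((fun y : Rd => q (y 0 i)) \o shift x)
      (h *: delta_mx 0 j) - q (x 0 i))) =
    if i == j then (fun h : R => h^-1 *: ((q \o shift (x 0 i)) (h *: 1) - q (x 0 i)))
    else cst 0.
  apply/funext => h; rewrite /= !mxE eqxx /=; case: eqP => _ /=; first by [].
  by rewrite mulr0 add0r subrr scaler0.
split; rewrite /derivable /derive E; case: eqP => // _; first exact: is_cvg_cst.
exact: lim_cst.
Qed.

Lemma smooth_flat_exp_coord (a b : R) i :
  smooth (fun x : Rd => flat_exp 1 (a * x 0 i + b)).
Proof.
pose F c a b (i : 'I_d) p : Rd -> R := fun x => c * flat_exp p (a * x 0 i + b).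
have FD c a' b' i' p x j : is_derive x (delta_mx 0 j : Rd) (F c a' b' i' p)
    (F (if i' == j then c * a' else 0) a' b' i' ('X^2 * (p - p^`())) x).
  have dl : is_derive (x 0 i') (1 : R) (fun u : R => a' * u + b') (a' * 1 + 0).
    exact: is_deriveD.
  have dq := @is_derive1_comp _ (flat_exp p) (fun u => a' * u + b') _ _ _
    (is_derive_flat_exp p (a' * x 0 i' + b')) dl.
  apply: (is_derive_eq (is_deriveZ c (is_derive_coord j dq))).
  rewrite /F -[_ *: _]/(_ * _); case: eqP => _; last by rewrite mulr0 mul0r.
  by rewrite mulr1 addr0 -mulrA [_ * a']mulrC.
apply: (@smooth_coind _ _ (fun f => exists c a b i p, f = F c a b i p)).
- move=> _ [c [{}a [{}b [{}i [p ->]]]]] x.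
  have cx : ((y : Rd) 0 i : R) @[y --> x] --> (x 0 i : R) by exact: coord_continuous.
  have cq : flat_exp p (a * (y : Rd) 0 i + b) @[y --> x] --> flat_exp p (a * x 0 i + b).
    apply: (continuous_cvg _ _ (cvgD (cvgM (cvg_cst a) cx) (cvg_cst b))).
    exact: flat_exp_continuous.
  exact: (cvgM (cvg_cst c) cq).
- by move=> _ x j [c [{}a [{}b [{}i [p ->]]]]]; exact: (@ex_derive _ _ _ _ _ _ _ (FD _ _ _ _ _ _ _)).
- move=> _ j [c [{}a [{}b [{}i [p ->]]]]].
  exists (if i == j then c * a else 0), a, b, i, ('X^2 * (p - p^`())).
  by apply/funext => x; exact: (@derive_val _ _ _ _ _ _ _ (FD _ _ _ _ _ _ _)).
- by exists 1, a, b, i, 1; apply/funext => x; rewrite /F mul1r.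
Qed.

Lemma smooth_prod (I : Type) (s : seq I) (F : I -> Rd -> R) :
  (forall i, smooth (F i)) -> smooth (fun x => \prod_(i <- s) F i x).
Proof.
move=> sF; elim: s => [|i s ih].
  by under eq_fun do rewrite big_nil; exact: smooth_cst.
by under eq_fun do rewrite big_cons; exact: smoothM.
Qed.

Definition box (a b : Rd) : set Rd := [set x | forall i, a 0 i < x 0 i < b 0 i].

(** The dilations by [k + 1] make the bumps tend to the indicator of the open box. *)
Definition box_bump (a b : Rd) k : Rd -> R := fun x =>
  \prod_i (flat_exp 1 (k.+1%:R * (x 0 i - a 0 i)) *
           flat_exp 1 (k.+1%:R * (b 0 i - x 0 i))).

Lemma box_bump_itv a b k x : 0 <= box_bump a b k x <= 1.
Proof.
rewrite /box_bump; apply/andP; split.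
  apply: prodr_ge0 => i _; apply: mulr_ge0; first by case/andP: (flat_exp1_itv (k.+1%:R * (x 0 i - a 0 i))).
  by case/andP: (flat_exp1_itv (k.+1%:R * (b 0 i - x 0 i))).
apply: prodr_ile1 => i _.
case/andP: (flat_exp1_itv (k.+1%:R * (x 0 i - a 0 i))) => h1 h2.
case/andP: (flat_exp1_itv (k.+1%:R * (b 0 i - x 0 i))) => h3 h4.
by rewrite mulr_ge0//= mulr_ile1.
Qed.

Lemma test_function_box_bump a b k : test_function (box_bump a b k).
Proof.
split.
  apply: smooth_prod => i.
  apply: (@smoothM _ _ (fun x => flat_exp 1 (k.+1%:R * (x 0 i - a 0 i)))
    (fun x => flat_exp 1 (k.+1%:R * (b 0 i - x 0 i)))).
    rewrite (_ : (fun _ => _) = fun x : Rd => flat_exp 1 (k.+1%:R * x 0 i + - (k.+1%:R * a 0 i))).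
      exact: smooth_flat_exp_coord.
    by apply/funext => x; rewrite mulrBr.
  rewrite (_ : (fun _ => _) = fun x : Rd => flat_exp 1 (- k.+1%:R * x 0 i + k.+1%:R * b 0 i)).
    exact: smooth_flat_exp_coord.
  by apply/funext => x; rewrite mulrBr mulNr addrC.
have cK : compact [set x : Rd | forall i, `[a 0 i, b 0 i]%classic (x ord0 i)].
  by apply: (@rV_compact _ _ (fun i => `[a 0 i, b 0 i]%classic)) => i; exact: segment_compact.
apply: (compact_tsupport_sub cK).
  exact: (compact_closed (@norm_hausdorff _ _) cK).
move=> x x0 i; rewrite /= in_itv/=.
move: x0; rewrite /box_bump (bigD1 i)//= !mulf_eq0 !negb_or -andbA => /and3P[+ + _].
rewrite /flat_exp; case: ifPn; last by rewrite eqxx.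
case: ifPn; last by rewrite eqxx.
by rewrite !pmulr_rgt0// !subr_gt0 => /ltW -> /ltW ->.
Qed.

Lemma cvg_box_bump a b x :
  box_bump a b k x @[k --> \oo] --> (\1_(box a b) x : R).
Proof.
have -> : \1_(box a b) x = \prod_i ((if 0 < x 0 i - a 0 i then 1 else 0) *
    (if 0 < b 0 i - x 0 i then 1 else 0)) :> R.
  have [xab|] := pselect (box a b x).
    rewrite indicE mem_set// big1// => i _; have /andP[xa xb] := xab i.
    by rewrite !subr_gt0 xa xb mulr1.
  move=> nx; rewrite indicE memNset//.
  have /existsNP[i ni] := nx; rewrite (bigD1 i)//= !subr_gt0.
  by move/negP: ni; rewrite negb_and => /orP[] /negbTE ->; rewrite ?mul0r ?mulr0 ?mul0r.
apply: cvg_big => [|i _]; first exact: mul_continuous.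
exact: (cvgM (@cvg_flat_exp1 _ _) (@cvg_flat_exp1 _ _)).
Qed.
End bumps.

(** * Borel sets and boxes *)

Section borel_boxes.
Context {R : realType} {d : nat}.
Local Notation Rd := 'rV[R]_d.

Definition rat_box (pq : 'rV[rat]_d * 'rV[rat]_d) : set Rd :=
  box (map_mx ratr pq.1) (map_mx ratr pq.2).

Lemma open_bigcup_rat_box (U : set Rd) : open U ->
  U = \bigcup_(pq in [set pq | rat_box pq `<=` U]) rat_box pq.
Proof.
move=> oU; apply/seteqP; split=> [x Ux|x [pq pqU]]; last exact: pqU.
have /nbhs_ballP[e /= e0 xeU] : nbhs x U by exact: open_nbhs_nbhs.
have hp i : exists p : rat, x 0 i - e < ratr p < x 0 i.
  have /rat_in_itvoo[p pi] : x 0 i - e < x 0 i by rewrite ltrBlDr ltrDl.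
  by exists p; rewrite in_itv in pi.
have hq i : exists q : rat, x 0 i < ratr q < x 0 i + e.
  have /rat_in_itvoo[q qi] : x 0 i < x 0 i + e by rewrite ltrDl.
  by exists q; rewrite in_itv in qi.
have /choice[p pP] := hp; have /choice[q qP] := hq.
exists (\row_i p i, \row_i q i) => [y yB|i]; last first.
  by rewrite !mxE; case/andP: (pP i) => _ ->; case/andP: (qP i) => ->.
apply: xeU; split=> // j i; rewrite ord1; have := yB i; rewrite !mxE => /andP[y1 y2].
rewrite /ball /= ltr_norml; have /andP[p1 p2] := pP i; have /andP[q1 q2] := qP i.
by apply/andP; split; lra.
Qed.

Lemma continuous_borelRd_measurable (f : Rd -> R) : continuous f ->
  measurable_fun (setT : set (borelRd R d)) f.
Proof.
move=> cf; apply: (measurability _ (RGenOpens.measurableE R)) => _ [_ [a [b ->] <-]].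
rewrite setTI; apply: sub_sigma_algebra.
by move/continuousP : cf; apply; exact: interval_open.
Qed.

Lemma coord_borelRd_measurable i :
  measurable_fun (setT : set (borelRd R d)) (fun x : Rd => x 0 i).
Proof. by apply: continuous_borelRd_measurable; exact: coord_continuous. Qed.

Lemma boxI (a b a' b' : Rd) : box a b `&` box a' b' =
  box (\row_i Num.max (a 0 i) (a' 0 i)) (\row_i Num.min (b 0 i) (b' 0 i)).
Proof.
apply/seteqP; split=> x /=.
  move=> [xab xab'] i; rewrite !mxE gt_max lt_min.
  by case/andP: (xab i) => -> ->; case/andP: (xab' i) => -> ->.
move=> h; split=> i; have := h i; rewrite !mxE gt_max lt_min => /andP[/andP[h1 h2] /andP[h3 h4]].
  by rewrite h1 h3.
by rewrite h2 h4.
Qed.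

Section preimages.
Context {disp : measure_display} {T : measurableType disp}.
Variable s : T -> Rd.
Hypothesis ms : vmeasurable s.

Lemma measurable_preimage_box (a b : Rd) : measurable (s @^-1` box a b).
Proof.
rewrite (_ : _ @^-1` _ = \bigcap_(i in [set: 'I_d])
    ((fun x => s x 0 i) @^-1` `]a 0 i, b 0 i[%classic)).
  apply: fin_bigcap_measurable => // i _.
  by rewrite -[X in measurable X]setTI; exact: ms.
apply/seteqP; split=> [x /= h i _|x /= h i]; first by rewrite /= in_itv/=.
by have := h i Logic.I; rewrite /= in_itv.
Qed.

Lemma measurable_preimage_open (U : set Rd) : open U -> measurable (s @^-1` U).
Proof.
move=> oU; rewrite (open_bigcup_rat_box oU) preimage_bigcup.
rewrite bigcup_mkcond.
apply: (@countable_bigcupT_measurable _ _ _ _) => // pq.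
by case: ifP => // _; exact: measurable_preimage_box.
Qed.
End preimages.

Lemma measurable_box (a b : Rd) : measurable (box a b : set (borelRd R d)).
Proof.
exact: (@measurable_preimage_box _ (borelRd R d) id coord_borelRd_measurable).
Qed.

Lemma borelRd_boxE : @measurable _ (borelRd R d) =
  <<s [set B : set Rd | exists a b, B = box a b] >>.
Proof.
apply/seteqP; split=> A.
  apply: smallest_sub; first exact: smallest_sigma_algebra.
  move=> U /= oU; rewrite (open_bigcup_rat_box oU) bigcup_mkcond.
  apply: (@countable_bigcupT_measurable _
    (g_sigma_algebraType [set B : set Rd | exists a b, B = box a b])) => // pq.
  case: ifP => // _; apply: sub_sigma_algebra.
  by exists (map_mx ratr pq.1), (map_mx ratr pq.2).
apply: smallest_sub; first exact: sigma_algebra_measurable.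
by move=> _ [a [b ->]]; exact: measurable_box.
Qed.

(** Dynkin's pi-lambda theorem for the pi-system of open boxes. *)
Lemma borelRd_ind (P : set (borelRd R d) -> Prop) :
  P setT -> (forall a b, P (box a b)) ->
  (forall A, measurable A -> P A -> P (~` A)) ->
  (forall F : (set (borelRd R d))^nat, (forall n, measurable (F n)) ->
     trivIset setT F -> (forall n, P (F n)) -> P (\bigcup_k F k)) ->
  forall A, measurable A -> P A.
Proof.
move=> PT PB PC PU A; rewrite borelRd_boxE.
apply: (dynkin_induction borelRd_boxE) => //.
  by move=> _ _ [a [b ->]] [a' [b' ->]]; rewrite boxI; do 2 eexists.
by move=> _ [a [b ->]].
Qed.

End borel_boxes.

(** * Tangent fields *)

Section integrals_of_fields.
Context {disp : measure_display} {T : measurableType disp} {R : realType} {n : nat}.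
Variable mu : {measure set T -> \bar R}.
Implicit Types (g s : T -> 'rV[R]_n).

Definition l1norm s := \int[mu]_x \sum_i `|s x 0 i|.

Lemma integrable_sum_norm s : vintegrable mu s ->
  mu.-integrable setT (EFin \o (fun x => \sum_i `|s x 0 i|)).
Proof.
move=> si; rewrite (_ : _ \o _ = fun x => (\sum_i `|(s x 0%R i)%:E|)%E).
  by apply: integrable_sum => // i _; exact: integrable_abse.
by apply/funext => x; rewrite /= sumEFin.
Qed.

Lemma normr_dotv_le g s (M : R) x : (forall x i, `|g x 0 i| <= M) ->
  `|dotv (g x) (s x)| <= M * \sum_i `|s x 0 i|.
Proof.
move=> gM; rewrite /dotv (le_trans (ler_norm_sum _ _ _))// mulr_sumr.
by apply: ler_sum => i _; rewrite normrM ler_wpM2r.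
Qed.

Lemma integrable_dotv g s (M : R) : vmeasurable g -> (forall x i, `|g x 0 i| <= M) ->
  vintegrable mu s -> mu.-integrable setT (EFin \o (fun x => dotv (g x) (s x))).
Proof.
move=> mg gM si.
apply: (le_integrable measurableT _ _ (integrableZl measurableT M (integrable_sum_norm si))).
  by apply/measurable_EFinP; apply: vmeasurable_dotv => //; exact: vintegrable_measurable si.
by move=> x _ /=; rewrite lee_fin (le_trans (normr_dotv_le s x gM))// ler_norm.
Qed.

Lemma normr_Rintegral_dotv_le g s (M : R) : vmeasurable g ->
  (forall x i, `|g x 0 i| <= M) -> vintegrable mu s ->
  `|\int[mu]_x dotv (g x) (s x)| <= M * l1norm s.
Proof.
move=> mg gM si; have di := integrable_dotv mg gM si.
apply: (le_trans (le_normr_Rintegral measurableT di)).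
have si' := integrable_sum_norm si.
rewrite /l1norm -RintegralZl//; apply: le_Rintegral => //.
- exact: integrable_norm di.
- exact: (integrableZl measurableT M si').
- by move=> x _; exact: normr_dotv_le.
Qed.

Lemma Rintegral_dotvDr g s t (a M : R) : vmeasurable g ->
  (forall x i, `|g x 0 i| <= M) -> vintegrable mu s -> vintegrable mu t ->
  \int[mu]_x dotv (g x) (a *: s x + t x) =
  a * (\int[mu]_x dotv (g x) (s x)) + \int[mu]_x dotv (g x) (t x).
Proof.
move=> mg gM si ti; have ds := integrable_dotv mg gM si; have dt := integrable_dotv mg gM ti.
rewrite -RintegralZl// -RintegralD//; last exact: (integrableZl measurableT a ds).
by apply: eq_Rintegral => x _; rewrite dotvC dotvDl dotvZl ![dotv _ (g x)]dotvC.
Qed.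

End integrals_of_fields.

Section tangent_fields.
Context {R : realType} {d : nat}.
Local Notation Rd := 'rV[R]_d.
Local Notation B := (borelRd R d).
Variable mu : {measure set B -> \bar R}.
Implicit Types (s : B -> Rd) (phi : Rd -> R).

Lemma vmeasurable_grad phi : test_function phi -> vmeasurable (grad phi : B -> Rd).
Proof.
move=> tphi i; under eq_fun do rewrite mxE.
apply: continuous_borelRd_measurable; apply: smooth_continuous.
exact: smooth_partial tphi.1.
Qed.

Lemma grad_bounded phi : test_function phi -> exists M, forall x i, `|grad phi x 0 i| <= M.
Proof.
move=> tphi; have /choice[M hM] := fun i => test_function_bounded (test_function_partial i tphi).
exists (\sum_i `|M i|) => x i; rewrite mxE (le_trans (hM i x))//.
by rewrite (bigD1 i)//= (le_trans (ler_norm _))// lerDl sumr_ge0.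
Qed.

Lemma partial_le_grad phi i x : `|partial i phi x| <= enorm (grad phi x).
Proof. by have := coord_le_enorm (grad phi x) i; rewrite mxE. Qed.

Lemma ndiv_density_lin a s t phi : L1 mu s -> L1 mu t -> test_function phi ->
  ndiv_density mu (fun x => a *: s x + t x) phi =
  a * ndiv_density mu s phi + ndiv_density mu t phi.
Proof.
move=> si ti tphi; have [M hM] := grad_bounded tphi.
by rewrite /ndiv_density (Rintegral_dotvDr _ (vmeasurable_grad tphi) hM).
Qed.

Lemma ndiv_density_distribution s : L1 mu s -> Defs.distribution (ndiv_density mu s).
Proof.
move=> si; split=> [a f g tf tg|phi tphi [_ cphi]].
  have [M hM] := grad_bounded tf; have [N hN] := grad_bounded tg.
  have fi := integrable_dotv (vmeasurable_grad tf) hM si.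
  have gi := integrable_dotv (vmeasurable_grad tg) hN si.
  rewrite /ndiv_density -RintegralZl// -RintegralD//; last exact: (integrableZl measurableT a fi).
  apply: eq_Rintegral => x _; rewrite -dotvZl -dotvDl; congr dotv.
  by apply/rowP => i; rewrite !mxE partial_lin//; [exact: tf.1|exact: tg.1].
apply/cvgrPdist_le => e e0; have l0 : 0 <= l1norm mu s.
  by apply: Rintegral_ge0 => x _; exact: sumr_ge0.
have e'0 : 0 < e / (l1norm mu s + 1) by rewrite divr_gt0// ltr_wpDl.
have : \forall n \near \oo, forall i x, `|partial i (phi n) x| <= e / (l1norm mu s + 1).
  apply: filter_forall => i; exact: (cphi [:: i] _ e'0).
apply: filterS => n hn; rewrite sub0r normrN.
have hg x i : `|grad (phi n) x 0 i| <= e / (l1norm mu s + 1) by rewrite mxE.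
apply: (le_trans (normr_Rintegral_dotv_le (vmeasurable_grad (tphi n)) hg si)).
rewrite -mulrA ler_piMr ?(ltW e0)// mulrC ler_pdivrMr ?mul1r ?lerDl//.
by rewrite ltr_wpDl.
Qed.

Lemma tangent_fieldsP s : tangent_fields mu s <-> L1 mu s /\
  forall (phi : (Rd -> R)^nat) (c : R), (forall n, test_function (phi n)) ->
    (exists L : R, forall n x, enorm (grad (phi n) x) <= L) ->
    (forall x, phi n x @[n --> \oo] --> c) ->
    ndiv_density mu s (phi n) @[n --> \oo] --> 0.
Proof.
split=> [[si [_ h]]//|[si h]]; split => //; split => //.
exact: ndiv_density_distribution.
Qed.

Lemma tangent_fields_lin a s t : tangent_fields mu s -> tangent_fields mu t ->
  tangent_fields mu (fun x => a *: s x + t x).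
Proof.
move=> /tangent_fieldsP[si sh] /tangent_fieldsP[ti th]; apply/tangent_fieldsP.
split=> [|phi c tphi L cphi]; first exact: vintegrable_lin.
under eq_fun do rewrite ndiv_density_lin//.
have := cvgD (cvgM (cvg_cst a) (sh _ _ tphi L cphi)) (th _ _ tphi L cphi).
by rewrite mulr0 addr0; apply.
Qed.

Lemma tangent_fields_ae s t : {ae mu, forall x, s x = t x} -> L1 mu t ->
  tangent_fields mu s -> tangent_fields mu t.
Proof.
move=> st ti /tangent_fieldsP[si sh]; apply/tangent_fieldsP; split => //.
move=> phi c tphi L cphi.
rewrite (_ : (fun n => _) = fun n => ndiv_density mu s (phi n)); first exact: sh cphi.
apply/funext => n; congr fine; apply: ae_eq_integral => //.
- apply/measurable_EFinP; apply: vmeasurable_dotv; first exact: vmeasurable_grad.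
  exact: vintegrable_measurable ti.
- apply/measurable_EFinP; apply: vmeasurable_dotv; first exact: vmeasurable_grad.
  exact: vintegrable_measurable si.
- by move: st; apply: filterS => x ->.
Qed.

(** Domination gives convergence in [L^1], and the pairings with test functions whose
gradients are at most [L] change by at most [L] times the [L^1] distance. *)
Lemma tangent_fields_dominated (s_ : (B -> Rd)^nat) s (g : B -> R) :
  (forall k, tangent_fields mu (s_ k)) -> vmeasurable s ->
  (forall x i, s_ k x 0 i @[k --> \oo] --> s x 0 i) ->
  mu.-integrable setT (EFin \o g) -> (forall k x i, `|s_ k x 0 i| <= g x) ->
  tangent_fields mu s.
Proof.
move=> ts ms cs gi sg.
have sgl x i : `|s x 0 i| <= g x.
  have h : `|s_ k x 0 i| @[k --> \oo] --> `|s x 0 i| by apply: cvg_norm; exact: cs.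
  rewrite -(cvg_lim _ h)//; apply: limr_le; first by apply/cvg_ex; eexists; exact: h.
  by apply: nearW => k.
have si : L1 mu s.
  move=> i; apply: (le_integrable measurableT _ _ gi); first by apply/measurable_EFinP; exact: ms.
  by move=> x _ /=; rewrite lee_fin (le_trans (sgl x i))// ler_norm.
have ski k : L1 mu (s_ k) by exact: (ts k).1.
have dist0 : l1norm mu (fun x => -1 *: s x + s_ k x) @[k --> \oo] --> 0.
  have -> : 0 = \int[mu]_x (cst 0 x : R) by rewrite Rintegral_cst// mul0r.
  apply: (@Rintegral_dominated_convergence _ _ _ mu _ _ (fun x => \sum_(i < d) (g x + g x)) _ _ _ _).2.
  - move=> k; apply: measurable_sum => i; apply: measurableT_comp => //.
    apply: vintegrable_measurable; exact: (vintegrable_lin (-1) si (ski k)).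
  - move=> x; rewrite (_ : cst 0 x = \sum_(i < d) `|0 : R|); last first.
      by rewrite big1// => i _; rewrite normr0.
    apply: cvg_big => [|i _]; first exact: add_continuous.
    apply: cvg_norm; under eq_fun do rewrite !mxE mulN1r.
    by rewrite -(addNr (s x 0 i)); apply: cvgD => //; exact: cvg_cst.
  - rewrite (_ : _ \o _ = fun x => (\sum_(i < d) (g x + g x)%:E)%E); last first.
      by apply/funext => x; rewrite /= sumEFin.
    by apply: integrable_sum => // i _; exact: (integrableD measurableT gi gi).
  - move=> k x; rewrite ger0_norm ?sumr_ge0//; apply: ler_sum => i _.
    by rewrite !mxE mulN1r (le_trans (ler_normD _ _))// normrN lerD.
apply/tangent_fieldsP; split => // phi c tphi [L hL] cphi.
have gL m x i : `|grad (phi m) x 0 i| <= `|L| + 1.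
  rewrite mxE (le_trans (partial_le_grad _ _ _))// (le_trans (hL m x))//.
  by rewrite (le_trans (ler_norm _))// lerDl.
have L0 : 0 < `|L| + 1 by rewrite ltr_wpDl.
apply/cvgrPdist_le => e e0.
have e20 : 0 < e / 2 / (`|L| + 1) by rewrite !divr_gt0.
have [k _ /(_ k (leqnn _)) hk] : \forall k \near \oo,
    `|0 - l1norm mu (fun x => -1 *: s x + s_ k x)| <= e / 2 / (`|L| + 1).
  by move/cvgrPdist_le : dist0; exact.
have /tangent_fieldsP[_ tk] := ts k.
have : \forall m \near \oo, `|0 - ndiv_density mu (s_ k) (phi m)| <= e / 2.
  have /cvgrPdist_le := tk _ _ tphi (ex_intro _ L hL) cphi; apply.
  by rewrite divr_gt0.
apply: filterS => m; rewrite !sub0r !normrN => h1.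
have E : ndiv_density mu s (phi m) = ndiv_density mu (s_ k) (phi m)
    - ndiv_density mu (fun x => -1 *: s x + s_ k x) (phi m).
  by rewrite ndiv_density_lin// mulN1r opprD opprK addrC subrK.
rewrite E (splitr e) (le_trans (ler_normB _ _))// lerD//.
apply: (le_trans (normr_Rintegral_dotv_le (vmeasurable_grad (tphi m)) (gL m)
  (vintegrable_lin (-1) si (ski k)))).
move: hk; rewrite sub0r normrN => /ler_normlW hk.
by rewrite mulrC -ler_pdivlMr.
Qed.

(** The Leibniz rule makes the tangent fields a module over the test functions.  Given
[phi_n --> c], the test functions [theta * (phi_n - c)] tend to 0 with bounded
gradients, and the remaining term [(phi_n - c) * grad theta] tends to 0 boundedly. *)
Lemma tangent_fieldsM_test theta s : test_function theta -> tangent_fields mu s ->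
  tangent_fields mu (fun x => theta x *: s x).
Proof.
move=> tt /tangent_fieldsP[si sh].
have [Mt hMt] := test_function_bounded tt.
have [Mg hMg] := grad_bounded tt.
have mt : measurable_fun setT (theta : B -> R).
  by apply: continuous_borelRd_measurable; exact: smooth_continuous tt.1.
apply/tangent_fieldsP; split=> [i|phi c tphi [L hL] cphi].
  have := integrable_bounded_mul mt hMt (si i).
  by under [X in _ -> mu.-integrable _ X]eq_fun do rewrite mxE.
have hL' i n x : `|partial i (phi n) x| <= L.
  exact: le_trans (partial_le_grad _ _ _) (hL n x).
pose psi n : Rd -> R := phi n - cst c.
have psiE n x : psi n x = phi n x - c by [].
have spsi n : smooth (psi n).
  have := smooth_lin (-1) (@smooth_cst R d c) (tphi n).1.
  by rewrite scaleN1r addrC.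
have ppsi n i x : partial i (psi n) x = partial i (phi n) x.
  have := partial_lin i (-1) x (@smooth_cst R d c) (tphi n).1.
  by rewrite scaleN1r addrC => ->; rewrite {1}/partial derive_cst mulr0 add0r.
have cpsi x : psi n x @[n --> \oo] --> 0.
  by rewrite -(subrr c); apply: cvgB; [exact: cphi|exact: cvg_cst].
(* by the convergence at 0 and the common Lipschitz constant *)
have [K hK] : exists K, forall n x, tsupport theta x -> `|psi n x| <= K.
  have [b0 hb0] : exists b, forall n, `|psi n 0| <= b.
    have [b [_ hb]] := cvg_seq_bounded (cvgP _ (cpsi 0)).
    by exists (b + 1) => n; apply: hb => //; rewrite ltrDl.
  have [r hr] : exists r, forall x, tsupport theta x -> \sum_i `|x 0 i| <= r.
    have cS : continuous (fun x : Rd => \sum_i `|x 0 i|).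
      move=> x; have cx i : ((y : Rd) 0 i : R) @[y --> x] --> (x 0 i : R).
        exact: coord_continuous.
      have nf : Filter (nbhs x) by exact: nbhs_filter.
      apply: (@cvg_big _ _ _ _ _ add_continuous _ _ _ _ _ nf) => i _.
      by apply: cvg_norm; exact: cx.
    have /compact_bounded[r [_ hr]] : compact [set \sum_i `|x 0 i| | x in tsupport theta].
      by apply: continuous_compact tt.2; exact: continuous_subspaceT.
    exists (r + 1) => x tx; apply: le_trans (ler_norm _) _.
    by apply: (hr (r + 1)); [rewrite ltrDl|exists x].
  exists (`|L| * r + b0) => n x tx.
  rewrite -(subrK (psi n 0) (psi n x)) (le_trans (ler_normD _ _))// lerD//.
  rewrite (le_trans (lipschitz_of_partials (L := `|L|) (spsi n) _ _ _))//.
    by move=> i y; rewrite ppsi (le_trans (hL' i n y))// ler_norm.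
  rewrite ler_wpM2l//; apply: le_trans (hr x tx).
  by apply: ler_sum => i _; rewrite mxE subr0.
have ttpsi n : test_function (theta * psi n) by exact: test_functionMl.
have ptpsi n i x : partial i (theta * psi n) x =
    theta x * partial i (phi n) x + psi n x * partial i theta x.
  by rewrite partialM//; [rewrite ppsi|exact: tt.1].
have rest_le n x i : `|(psi n x *: grad theta x) 0 i| <= `|K| * `|Mg|.
  rewrite !mxE normrM; have [->|pt] := eqVneq (partial i theta x) 0.
    by rewrite normr0 mulr0 mulr_ge0.
  have tx := partial_tsupport pt.
  apply: ler_pM => //; first exact: le_trans (hK n x tx) (ler_norm _).
  by have := hMg x i; rewrite mxE => /le_trans; apply; exact: ler_norm.
have mrest n : vmeasurable ((fun x => psi n x *: grad theta x) : B -> Rd).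
  move=> i; under eq_fun do rewrite mxE; apply: measurable_funM.
    by apply: continuous_borelRd_measurable; exact: smooth_continuous.
  exact: vmeasurable_grad.
have E n : ndiv_density mu (fun x => theta x *: s x) (phi n) =
    ndiv_density mu s (theta * psi n) - \int[mu]_x dotv (psi n x *: grad theta x) (s x).
  have [M hM] := grad_bounded (ttpsi n).
  rewrite /ndiv_density -RintegralB//; last 2 first.
  - exact: (integrable_dotv (vmeasurable_grad (ttpsi n)) hM si).
  - exact: (integrable_dotv (mrest n) (rest_le n) si).
  apply: eq_Rintegral => x _; rewrite /dotv -sumrB; apply: eq_bigr => i _.
  by rewrite !mxE ptpsi; ring.
under eq_fun do rewrite E.
rewrite -(subrr (0 : R)); apply: cvgB.
  apply: (sh (fun n => theta * psi n) 0) => //.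
    exists (\sum_(i < d) (`|Mt| * `|L| + `|K| * `|Mg|)) => n x.
    apply: le_trans (enorm_le_coord _) _; apply: ler_sum => i _.
    rewrite mxE ptpsi (le_trans (ler_normD _ _))// lerD//.
      rewrite normrM; apply: ler_pM => //.
        exact: le_trans (hMt x) (ler_norm _).
      exact: le_trans (hL' i n x) (ler_norm _).
    by have := rest_le n x i; rewrite !mxE.
  by move=> x; rewrite -(mulr0 (theta x)); apply: cvgM => //; exact: cvg_cst.
have -> : 0 = \int[mu]_x (cst 0 x : R) by rewrite Rintegral_cst// mul0r.
apply: (@Rintegral_dominated_convergence _ _ _ mu _ _
    (fun x => (`|K| * `|Mg|) * \sum_i `|s x 0 i|) _ _ _ _).2.
- by move=> n; apply: vmeasurable_dotv => //; exact: vintegrable_measurable si.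
- move=> x; under eq_fun do rewrite dotvZl.
  by rewrite /= -(mul0r (dotv (grad theta x) (s x))); apply: cvgM => //; exact: cvg_cst.
- exact: (integrableZl measurableT _ (integrable_sum_norm si)).
- by move=> n x; exact: (normr_dotv_le s x (rest_le n)).
Qed.

End tangent_fields.

Section tangent_fields_module.
Context {R : realType} {d : nat}.
Local Notation Rd := 'rV[R]_d.
Local Notation B := (borelRd R d).
Variable mu : {measure set B -> \bar R}.
Implicit Types (s : B -> Rd).

Lemma tangent_fields_measurable s : tangent_fields mu s -> vmeasurable s.
Proof. by case=> si _; exact: vintegrable_measurable si. Qed.

Let cvg_scaled (f_ : (B -> R)^nat) (f : B -> R) s x i :
  f_ k x @[k --> \oo] --> f x ->
  (f_ k x *: s x) 0 i @[k --> \oo] --> (f x *: s x) 0 i.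
Proof.
move=> ff; rewrite mxE; under eq_fun do rewrite mxE.
by apply: cvgM => //; exact: cvg_cst.
Qed.

Let vmeasurableZ (f : B -> R) s : measurable_fun setT f -> vmeasurable s ->
  vmeasurable (fun x => f x *: s x).
Proof. by move=> mf ms i; under eq_fun do rewrite mxE; exact: measurable_funM. Qed.

(** The indicator of a box is a bounded limit of test functions, and Dynkin's theorem
extends the claim from boxes to Borel sets. *)
Let tangent_fields_indic s A : tangent_fields mu s -> measurable A ->
  tangent_fields mu (fun x => \1_A x *: s x).
Proof.
move=> ts; have ms := tangent_fields_measurable ts.
have ei := vintegrable_enorm ts.1.
have m1 D : measurable D -> measurable_fun setT (\1_D : B -> R) by exact: measurable_indic.
have le1 (a : R) x i : 0 <= a <= 1 -> `|(a *: s x) 0 i| <= enorm (s x).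
  move=> /andP[a0 a1]; rewrite mxE normrM (ger0_norm a0).
  by apply: le_trans (coord_le_enorm _ i); rewrite ler_piMl.
apply: (@borelRd_ind _ _ (fun A => tangent_fields mu (fun x => \1_A x *: s x))).
- by under eq_fun do rewrite indicT scale1r.
- move=> a b; apply: (tangent_fields_dominated (s_ := fun k x => box_bump a b k x *: s x) _ _ _ ei).
  + by move=> k; apply: tangent_fieldsM_test => //; exact: test_function_box_bump.
  + by apply: vmeasurableZ => //; apply: m1; exact: measurable_box.
  + by move=> x i; apply: cvg_scaled; exact: cvg_box_bump.
  + by move=> k x i; apply: le1; exact: box_bump_itv.
- move=> D _ tD; have := tangent_fields_lin (-1) tD ts.
  congr (tangent_fields mu); apply/funext => x.
  rewrite !indicE in_setC; case: (_ \in _) => /=.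
    by rewrite scale1r scale0r scaleN1r addNr.
  by rewrite scale0r scaler0 add0r scale1r.
- move=> F mF tF tFn.
  have tk k : tangent_fields mu (fun x => \1_(\big[setU/set0]_(i < k) F i) x *: s x).
    elim: k => [|k ih].
      have := tangent_fields_lin (-1) ts ts.
      congr (tangent_fields mu); apply/funext => x.
      by rewrite big_ord0 indic0 scale0r scaleN1r addNr.
    have := tangent_fields_lin 1 ih (tFn k).
    congr (tangent_fields mu); apply/funext => x.
    rewrite scale1r -scalerDl big_ord_recr /= !indicE in_setU.
    case: (boolP (x \in F k)) => xk; last by rewrite addr0 orbF.
    have /negbTE -> : x \notin \big[setU/set0]_(i < k) F i.
      apply/negP => xk'.
      have : (\big[setU/set0]_(i < k) F i `&` F k) x by split; exact/set_mem.
      by rewrite (@trivIset_bigsetUI _ predT)// /predT /= trueE.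
    by rewrite add0r.
  apply: (tangent_fields_dominated tk _ _ ei).
  + by apply: vmeasurableZ => //; apply: m1; exact: bigcup_measurable.
  + move=> x i.
    apply: (@cvg_scaled (fun k => \1_(\big[setU/set0]_(i < k) F i)) \1_(\bigcup_k F k)).
    have [[j _ Fjx]|nF] := pselect ((\bigcup_k F k) x).
      rewrite indicE mem_set; last by exists j.
      apply: (@cvg_near_cst _ _ _ _ \oo); exists j.+1 => // k /= jk.
      by rewrite indicE mem_set// -bigcup_mkord; exists j.
    rewrite indicE memNset//; apply: (@cvg_near_cst _ _ _ _ \oo); apply: nearW => k.
    rewrite indicE memNset// -bigcup_mkord => -[j _ Fjx]; apply: nF; exists j => //.
  + by move=> k x i; apply: le1; rewrite indicE; case: (_ \in _); rewrite ?lexx ?ler01.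
Qed.

(** [g] may be unbounded: its approximants are dominated by [g], so that the fields they
give are dominated by [g s]. *)
Lemma tangent_fieldsM (g : B -> R) s : tangent_fields mu s ->
  measurable_fun setT g -> L1 mu (fun x => g x *: s x) ->
  tangent_fields mu (fun x => g x *: s x).
Proof.
move=> ts mg gsi; have ms := tangent_fields_measurable ts.
have [f [tf mf fg fle]] := @measurable_fun_approx _ _ _
  (fun f => tangent_fields mu (fun x => f x *: s x))
  (fun A mA => tangent_fields_indic ts mA)
  (fun a f h tf th => eq_ind _ (tangent_fields mu)
     (tangent_fields_lin a tf th) _ (funext (fun x =>
       etrans (congr1 (+%R^~ _) (scalerA _ _ _)) (esym (scalerDl _ _ _))))) g mg.
apply: (tangent_fields_dominated tf _ _ (vintegrable_enorm gsi)).
- exact: vmeasurableZ.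
- by move=> x i; apply: cvg_scaled; exact: fg.
- move=> k x i; apply: le_trans (coord_le_enorm _ i) _.
  by rewrite !enormZ ler_wpM2r ?enorm_ge0.
Qed.

End tangent_fields_module.

(** * Orthonormal frames of tangent fields *)

Section exhaustion.
Context {disp : measure_display} {T : measurableType disp} {R : realType}.
Local Open Scope ereal_scope.

(** The union of a sequence of members whose measures tend to the supremum cannot be
essentially enlarged. *)
Lemma exhaustion (mu : {finite_measure set T -> \bar R}) (P : set (set T)) :
  P set0 -> (forall A, P A -> measurable A) ->
  (forall F : (set T)^nat, (forall k, P (F k)) -> P (\bigcup_k F k)) ->
  exists2 A, P A & forall B, P B -> mu (B `\` A) = 0.
Proof.
move=> P0 Pm PU.
pose S := [set fine (mu A) | A in P].
have mfin A : P A -> mu A \is a fin_num by move=> /Pm mA; rewrite fin_num_measure.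
have S0 : S !=set0 by exists (fine (mu set0)), set0.
have Sub : has_sup S.
  split => //; exists (fine (mu setT)) => _ [A PA <-].
  apply: fine_le; [exact: mfin|exact: fin_num_measure|].
  by apply: le_measure; rewrite ?inE//; exact: Pm.
have /choice[F hF] : forall k : nat, exists A, P A /\ (sup S - k.+1%:R^-1 < fine (mu A))%R.
  move=> k; have k0 : (0 < k.+1%:R^-1 :> R)%R by rewrite invr_gt0 ltr0n.
  by have [_ [A PA <-] h] := sup_adherent k0 Sub; exists A.
pose A := \bigcup_k F k.
have PA : P A by apply: PU => k; exact: (hF k).1.
exists A => // B PB.
have PAB : P (A `|` B) by rewrite -bigcup2E; apply: PU => -[|[|k]].
have mA := Pm _ PA; have mB := Pm _ PB; have mAB := Pm _ PAB.
have le1 : (sup S <= fine (mu A))%R.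
  rewrite leNgt; apply/negP => lt; have e0 : (0 < sup S - fine (mu A))%R by rewrite subr_gt0.
  have [k _ /(_ k (leqnn _)) hk] := near_infty_natSinv_lt (PosNum e0).
  have := (hF k).2; apply/negP; rewrite -leNgt.
  apply: (@le_trans _ _ (fine (mu A))); last first.
    by rewrite lerBrDl -lerBrDr; exact: ltW hk.
  apply: fine_le; [exact: mfin (hF k).1|exact: mfin|].
  by apply: le_measure; rewrite ?inE; [exact: Pm (hF k).1|exact: Pm|exact: bigcup_sup].
have le2 : (fine (mu (A `|` B)) <= sup S)%R.
  by apply: sup_upper_bound => //; exists (A `|` B).
have E : mu (A `|` B) = mu A + mu (B `\` A).
  by rewrite -measureU ?setDIK//; [rewrite setUDr setDv setD0|exact: measurableD].
have fA := mfin _ PA; have fBA : mu (B `\` A) \is a fin_num.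
  by rewrite fin_num_measure//; exact: measurableD.
apply/eqP; rewrite eq_le measure_ge0 andbT -(fineK fBA) lee_fin.
by move: (le_trans le2 le1); rewrite E fineD// gerDl.
Qed.
End exhaustion.

Section orthonormal.
Context {R : realType} {n : nat}.
Implicit Types u v : 'rV[R]_n.

Definition unit_or_zero v := v = 0 \/ dotv v v = 1.

Lemma dotv_suml (I : Type) (r : seq I) (F : I -> 'rV[R]_n) v :
  dotv (\sum_(i <- r) F i) v = \sum_(i <- r) dotv (F i) v.
Proof.
elim: r => [|i r ih]; first by rewrite !big_nil dotv0l.
by rewrite !big_cons dotvDl ih.
Qed.

Lemma unit_or_zero_enorm v : unit_or_zero v -> enorm v <= 1.
Proof.
by case=> [->|v1]; [rewrite enorm0 ler01|rewrite /enorm v1 sqrtr1].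
Qed.

Definition orthonormal_or_zero k (t : 'I_k -> 'rV[R]_n) :=
  (forall i j, i != j -> dotv (t i) (t j) = 0) /\ forall i, unit_or_zero (t i).

(** Orthogonal projection on the span of an orthonormal family, some vectors of
which may have been replaced by 0. *)
Definition projv k (t : 'I_k -> 'rV[R]_n) v := \sum_j dotv v (t j) *: t j.

Lemma projv_lin k (t : 'I_k -> 'rV[R]_n) a u v :
  projv t (a *: u + v) = a *: projv t u + projv t v.
Proof.
rewrite /projv scaler_sumr -big_split; apply: eq_bigr => j _ /=.
by rewrite dotvDl dotvZl scalerDl scalerA.
Qed.

Section orthonormal_family.
Variables (k : nat) (t : 'I_k -> 'rV[R]_n).
Hypothesis ot : orthonormal_or_zero t.

Lemma dotv_projv_t v i : dotv (projv t v) (t i) = dotv v (t i).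
Proof.
rewrite dotv_suml (bigD1 i)//= big1 ?addr0 => [|j ji]; last first.
  by rewrite dotvZl ot.1// mulr0.
by rewrite dotvZl; case: (ot.2 i) => [->|->]; rewrite ?dotv0r ?mulr0 ?mulr1.
Qed.

Lemma projvK v : projv t (projv t v) = projv t v.
Proof. by apply: eq_bigr => j _; rewrite dotv_projv_t. Qed.

Lemma dotv_sub_projv u v : dotv (u - projv t u) (projv t v) = 0.
Proof.
rewrite dotvC dotv_suml big1// => j _.
by rewrite dotvZl [dotv (t j) _]dotvC -scaleN1r addrC dotvDl dotvZl dotv_projv_t mulN1r addNr mulr0.
Qed.

Lemma pythagoras u v : projv t v = v ->
  enorm (u - v) ^+ 2 = enorm (u - projv t u) ^+ 2 + enorm (projv t u - v) ^+ 2.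
Proof.
move=> tv; rewrite !enorm_sqr.
have -> : u - v = (u - projv t u) + (projv t u - v) by rewrite addrA subrK.
set a := u - projv t u; set b := projv t u - v.
have ab : dotv a b = 0.
  rewrite /b -tv -scaleN1r addrC -projv_lin; exact: dotv_sub_projv.
by clearbody a b; rewrite dotvDl !dotvDr ab [dotv b a]dotvC ab addr0 add0r.
Qed.

Lemma enorm_sub_projv_le u v : projv t v = v ->
  enorm (u - projv t u) <= enorm (u - v).
Proof.
move=> tv; rewrite -(@ler_pXn2r _ 2) ?nnegrE ?enorm_ge0// (pythagoras u tv).
by rewrite lerDl sqr_ge0.
Qed.

Lemma enorm_projv_le u : enorm (projv t u) <= enorm u.
Proof.
have /(pythagoras u) : projv t 0 = 0.
  by rewrite /projv big1// => j _; rewrite dotv0l scale0r.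
rewrite !subr0 => h; rewrite -(@ler_pXn2r _ 2) ?nnegrE ?enorm_ge0// h.
by rewrite lerDr sqr_ge0.
Qed.

End orthonormal_family.

Lemma orthonormal_basis_eq0 (t : 'I_n -> 'rV[R]_n) v :
  (forall i j, dotv (t i) (t j) = (i == j)%:R) -> (forall i, dotv v (t i) = 0) -> v = 0.
Proof.
move=> ott vt; have [M ME] : exists M : 'M[R]_n, forall i j, M i j = t i 0 j.
  by exists (\matrix_i t i) => i j; rewrite mxE.
have MM : M *m M^T = 1%:M.
  apply/matrixP => i j; transitivity (dotv (t i) (t j)); last by rewrite ott mxE.
  rewrite mxE /dotv; by apply: eq_bigr => l _; rewrite mxE !ME.
have : v *m M^T = 0.
  apply/rowP => i; transitivity (dotv v (t i)); last by rewrite vt mxE.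
  rewrite mxE /dotv; by apply: eq_bigr => l _; rewrite mxE ME.
by move=> vM; rewrite -[v]mulmx1 -(mulmx1C MM) mulmxA vM mul0mx.
Qed.

End orthonormal.

Section frame.
Context {R : realType} {d : nat}.
Local Notation Rd := 'rV[R]_d.
Local Notation B := (borelRd R d).
Implicit Types (s : B -> Rd).

(** A description of the tangent fields by pointwise conditions: they are the integrable
fields that the projection on the frame leaves unchanged. *)
Definition tangent_frame (mu : {measure set B -> \bar R}) (tau : 'I_d -> B -> Rd) :=
  [/\ forall j, tangent_fields mu (tau j),
      forall x, orthonormal_or_zero (fun j => tau j x) &
      forall s, tangent_fields mu s ->
        {ae mu, forall x, projv (fun j => tau j x) (s x) = s x}].

Lemma tangent_fields0 (mu : {measure set B -> \bar R}) : tangent_fields mu (fun=> 0).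
Proof.
apply/tangent_fieldsP; split=> [i|phi c _ _ _].
  by under eq_fun do rewrite mxE; exact: integrable0.
rewrite (_ : (fun _ => _) = cst 0); first exact: cvg_cst.
apply/funext => n; rewrite /ndiv_density; under eq_Rintegral do rewrite dotv0r.
by rewrite Rintegral_cst// mul0r.
Qed.

Lemma tangent_fields_projv (mu : {measure set B -> \bar R}) k (tau : 'I_k -> B -> Rd) s :
  (forall j, tangent_fields mu (tau j)) ->
  (forall x j, unit_or_zero (tau j x)) -> L1 mu s ->
  tangent_fields mu (fun x => projv (fun j => tau j x) (s x)).
Proof.
move=> tt ut si; have ms := vintegrable_measurable si.
have mt j := tangent_fields_measurable (tt j).
have tj j : tangent_fields mu (fun x => dotv (s x) (tau j x) *: tau j x).
  apply: tangent_fieldsM => //; first exact: vmeasurable_dotv.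
  move=> i; apply: (le_integrable measurableT _ _ (vintegrable_enorm si)).
    apply/measurable_EFinP; under eq_fun do rewrite mxE.
    by apply: measurable_funM; [exact: vmeasurable_dotv|exact: mt].
  move=> x _; rewrite lee_fin [leRHS]ger0_norm ?enorm_ge0//.
  apply: le_trans (coord_le_enorm _ i) _; rewrite enormZ.
  have t1 := unit_or_zero_enorm (ut x j).
  rewrite -[leRHS]mulr1; apply: ler_pM => //; first exact: enorm_ge0.
  by rewrite (le_trans (normr_dotv_enorm _ _))// ler_piMr ?enorm_ge0.
rewrite /projv; elim: (index_enum _) => [|j r ih].
  by under eq_fun do rewrite big_nil; exact: tangent_fields0.
have := tangent_fields_lin 1 (tj j) ih; congr (tangent_fields mu).
by apply/funext => x; rewrite big_cons scale1r.
Qed.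

Section greedy.
Variable mu : {finite_measure set B -> \bar R}.
(* [V x] is the subspace in which the field is sought at [x]; in the greedy
construction below, the orthogonal of the vectors already chosen. *)
Variable V : B -> set Rd.
Hypothesis V_sub : forall x, V x 0 /\ forall a u v, V x u -> V x v -> V x (a *: u + v).

Let unit_sets : set (set B) := [set A | measurable A /\ exists s,
  [/\ tangent_fields mu s, forall x, V x (s x) & forall x, dotv (s x) (s x) = \1_A x]].

Let integrable1 : mu.-integrable setT (EFin \o cst (1 : R)).
Proof. exact: finite_measure_integrable_cst. Qed.

Let VZ x a u : V x u -> V x (a *: u).
Proof. by move=> xu; rewrite -[a *: u]addr0; apply: (V_sub x).2 => //; exact: (V_sub x).1. Qed.

Let indic_enorm (A : set B) (u : Rd) x : dotv u u = \1_A x -> enorm u <= 1.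
Proof.
by move=> uA; rewrite /enorm uA indicE; case: (_ \in _); rewrite ?sqrtr1 ?sqrtr0 ?ler01.
Qed.

Let unit_sets_bigcup (F : (set B)^nat) : (forall k, unit_sets (F k)) ->
  unit_sets (\bigcup_k F k).
Proof.
move=> /all_and2[mF /choice[s hs]]; split; first exact: bigcup_measurable.
pose A n := \big[setU/set0]_(i < n) F i.
have mA n : measurable (A n) by exact: bigsetU_measurable.
(* glue the fields one after the other, each on the part not yet covered *)
pose S := fix S n : B -> Rd := if n is m.+1 then
  fun x => S m x + \1_(~` A m) x *: s m x else fun=> 0.
have AS n x : A n.+1 x <-> A n x \/ F n x by rewrite /A big_ord_recr.
have S0 n x : ~ A n x -> S n x = 0.
  elim: n => // n ih nA /=.
  have /not_orP[nAn nFn] : ~ (A n x \/ F n x) by move/AS.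
  have [_ _ /(_ x)] := hs n; rewrite [RHS]indicE memNset// => /dotv_eq0 ->.
  by rewrite ih// scaler0 addr0.
have S1 n x : A n x -> S n.+1 x = S n x.
  by move=> An /=; rewrite indicE memNset ?scale0r ?addr0//; exact.
have SA n x : dotv (S n x) (S n x) = \1_(A n) x.
  elim: n => [|n ih]; first by rewrite /= dotv0l /A big_ord0 indic0.
  have [An|nAn] := pselect (A n x).
    by rewrite S1// ih !indicE !mem_set//; apply/AS; left.
  rewrite /= S0// add0r indicE mem_set// scale1r; have [_ _ ->] := hs n.
  have [Fn|nFn] := pselect (F n x); first by rewrite !indicE !mem_set//; apply/AS; right.
  by rewrite !indicE !memNset// => /AS[].
have SO n x : V x (S n x).
  elim: n => [|n ih]; first exact: (V_sub x).1.
  by rewrite /= addrC; apply: (V_sub x).2 => //; have [_ + _] := hs n; exact.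
have St n : tangent_fields mu (S n).
  elim: n => [|n ih]; first exact: tangent_fields0.
  have mI : measurable_fun setT (\1_(~` A n) : B -> R).
    by apply: measurable_indic; exact: measurableC.
  have [tsn _ dsn] := hs n.
  have := tangent_fields_lin 1 ih (_ : tangent_fields mu (fun x => \1_(~` A n) x *: s n x)).
  rewrite (_ : (fun x => 1 *: _ + _) = S n.+1); last first.
    by apply/funext => x /=; rewrite scale1r.
  apply; apply: tangent_fieldsM => // i.
  apply: (le_integrable measurableT _ _ (tsn.1 i)).
    apply/measurable_EFinP; under eq_fun do rewrite mxE.
    by apply: measurable_funM => //; exact: tangent_fields_measurable tsn i.
  move=> x _; rewrite /= lee_fin mxE normrM indicE ler_piMl//.
  by case: (_ \in _); rewrite ?normr1 ?normr0.
have /choice[N hN] : forall x, exists N, forall n, (N <= n)%N -> S n x = S N x.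
  move=> x; have [[k _ Fkx]|nF] := pselect ((\bigcup_k F k) x).
    exists k.+1 => n; elim: n => // n ih; rewrite leq_eqVlt => /orP[/eqP <- //|kn].
    rewrite S1 ?ih// /A -bigcup_mkord; by exists k.
  exists 0%N => n _; rewrite S0//= /A -bigcup_mkord => -[k _ Fkx].
  by apply: nF; exists k.
have cS x i : S n x 0 i @[n --> \oo] --> S (N x) x 0 i.
  by apply: (@cvg_near_cst _ _ _ _ \oo); exists (N x) => // n /= /hN ->.
have S_le n x i : `|S n x 0 i| <= 1.
  exact: le_trans (coord_le_enorm _ _) (indic_enorm (SA n x)).
exists (fun x => S (N x) x); split.
- apply: (tangent_fields_dominated St _ _ integrable1) => //.
  move=> i; apply: (measurable_fun_cvg (h := fun n x => S n x 0 i)).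
    by move=> n; exact: tangent_fields_measurable (St n) i.
  by move=> x _; exact: cS.
- by move=> x; exact: SO.
- move=> x; have [[k _ Fkx]|nF] := pselect ((\bigcup_k F k) x).
    have Akx n : (k < n)%N -> A n x by move=> kn; rewrite /A -bigcup_mkord; exists k.
    rewrite -(hN x (maxn (N x) k.+1)) ?leq_maxl// SA !indicE !mem_set//.
      by exists k.
    by apply: Akx; rewrite leq_maxr.
  rewrite SA !indicE !memNset// /A -bigcup_mkord => -[k _ Fkx].
  by apply: nF; exists k.
Qed.

(** Unit fields can be glued along disjoint sets, so their supports are stable under
countable unions and exhaustion yields an essentially largest one.  A tangent field is
zero outside it, since otherwise its normalization would have a support that is not
covered. *)
Lemma maximal_unit_field : exists s, [/\ tangent_fields mu s,
  forall x, V x (s x), forall x, unit_or_zero (s x) &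
  forall t, tangent_fields mu t -> (forall x, V x (t x)) ->
    {ae mu, forall x, s x = 0 -> t x = 0}].
Proof.
have [||A [mA [s [ts sO sA]]] hA] := @exhaustion _ _ _ mu unit_sets _ _ unit_sets_bigcup.
- split => //; exists (fun=> 0); split; [exact: tangent_fields0| |].
    by move=> x; exact: (V_sub x).1.
  by move=> x; rewrite indic0 dotv0l.
- by move=> A [].
exists s; split => //.
  move=> x; have := sA x; rewrite indicE; case: (_ \in _) => h; first by right.
  by left; exact: dotv_eq0.
move=> t tt tO; have mt := tangent_fields_measurable tt.
have me : measurable_fun setT (fun x => enorm (t x)) by exact: vmeasurable_enorm.
pose g x := (enorm (t x))^-1; pose D := [set x | t x <> 0].
have mg : measurable_fun setT g.
  have := measurableT_comp (@measurable_powR R (-1)) me.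
  by apply: eq_measurable_fun => x _; rewrite /= powR_inv1 ?enorm_ge0.
have DE : D = setT `&` (fun x => enorm (t x)) @^-1` `]0, +oo[%classic.
  apply/seteqP; split=> x /=; rewrite in_itv/= andbT.
    move=> tx; split => //; rewrite lt_neqAle enorm_ge0 andbT eq_sym.
    by apply/eqP => /enorm_eq0.
  by move=> [_] + t0; rewrite t0 enorm0 ltxx.
have mD : measurable D by rewrite DE; exact: me.
have gt1 x : dotv (g x *: t x) (g x *: t x) = \1_D x.
  rewrite dotvZl dotvC dotvZl -enorm_sqr /g.
  have [Dx|nDx] := pselect (D x).
    have e0 : enorm (t x) != 0 by apply/eqP => /enorm_eq0.
    by rewrite indicE mem_set// expr2 mulKf// mulVf.
  have -> : t x = 0 by apply: contrapT.
  by rewrite enorm0 invr0 !mul0r indicE memNset.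
have mgt : vmeasurable (fun x => g x *: t x).
  by move=> i; under eq_fun do rewrite mxE; exact: measurable_funM.
have PD : unit_sets D.
  split => //; exists (fun x => g x *: t x); split => //.
  - apply: tangent_fieldsM => // i.
    apply: (le_integrable measurableT _ _ integrable1); first by apply/measurable_EFinP; exact: mgt.
    move=> x _; rewrite /= lee_fin normr1.
    exact: le_trans (coord_le_enorm _ _) (indic_enorm (gt1 x)).
  - by move=> x; exact: VZ.
exists (D `\` A); split; [exact: measurableD|exact: hA|].
move=> x /= /not_implyP[sx tx]; split => // Ax.
have := sA x; rewrite sx dotv0l indicE mem_set//= => /eqP.
by rewrite eq_sym oner_eq0.
Qed.
End greedy.

(** Greedy construction.  A tangent field orthogonal to the [d] chosen fields can be
nonzero only where none of them vanishes, and there is no room for it there in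
dimension [d]. *)
Lemma tangent_frame_ex (mu : {finite_measure set B -> \bar R}) :
  exists tau, tangent_frame mu tau.
Proof.
have [tau [tt ott utt mtt]] : exists tau : nat -> B -> Rd, [/\
    forall j, tangent_fields mu (tau j),
    forall i j x, (i < j)%N -> dotv (tau i x) (tau j x) = 0,
    forall j x, unit_or_zero (tau j x) &
    forall j s, tangent_fields mu s ->
      (forall i x, (i < j)%N -> dotv (tau i x) (s x) = 0) ->
      {ae mu, forall x, tau j x = 0 -> s x = 0}].
  pose O (l : seq (B -> Rd)) x : set Rd := [set u | forall s, List.In s l -> dotv (s x) u = 0].
  have O_sub l x : O l x 0 /\ forall a u v, O l x u -> O l x v -> O l x (a *: u + v).
    split=> [s _|a u v xu xv s sl]; first exact: dotv0r.
    by rewrite dotvDr [dotv _ (_ *: _)]dotvC dotvZl dotvC xu// xv// mulr0 addr0.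
  have /choice[next hnext] := fun l => @maximal_unit_field mu (O l) (O_sub l).
  pose build := fix build n := if n is m.+1 then next (build m) :: build m else [::].
  pose tau n := next (build n).
  have inb i j : (i < j)%N -> List.In (tau i) (build j).
    elim: j => // j ih; rewrite ltnS leq_eqVlt => /orP[/eqP ->|ij]; [by left|right; exact: ih].
  have bin j s : List.In s (build j) -> exists2 i, (i < j)%N & s = tau i.
    elim: j => // j ih [<-|/ih[i ij ->]]; first by exists j.
    by exists i => //; rewrite ltnS ltnW.
  exists tau; split.
  - by move=> j; have [] := hnext (build j).
  - by move=> i j x ij; have [_ + _ _] := hnext (build j); apply; exact: inb.
  - by move=> j x; have [_ _ + _] := hnext (build j); exact.
  - move=> j s ts os; have [_ _ _ +] := hnext (build j); apply => // x _ /bin[i ij ->].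
    exact: os.
exists (fun j : 'I_d => tau j); split => //.
  move=> x; split => // i j ij; have [lt|lt] : (i < j)%N \/ (j < i)%N.
  - by apply/orP; rewrite -neq_ltn.
  - exact: ott.
  - by rewrite dotvC ott.
move=> s ts.
have ot x : orthonormal_or_zero (fun j : 'I_d => tau j x).
  split => // i j ij; have [lt|lt] : (i < j)%N \/ (j < i)%N.
  - by apply/orP; rewrite -neq_ltn.
  - exact: ott.
  - by rewrite dotvC ott.
pose r x := s x - projv (fun j : 'I_d => tau j x) (s x).
have tr : tangent_fields mu r.
  have tp := @tangent_fields_projv mu d (fun j => tau j) s (fun j => tt j) (fun x j => utt j x) ts.1.
  have := tangent_fields_lin (-1) tp ts; congr (tangent_fields mu).
  by apply/funext => x; rewrite scaleN1r addrC.
have orj (j : 'I_d) x : dotv (tau j x) (r x) = 0.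
  rewrite dotvC /r -scaleN1r addrC dotvDl dotvZl (dotv_projv_t (ot x)).
  by rewrite mulN1r addNr.
have : {ae mu, forall x, forall j : 'I_d, tau j x = 0 -> r x = 0}.
  apply: filter_forall => j; apply: mtt => // i x ij.
  exact: (orj (Ordinal (ltn_trans ij (ltn_ord j))) x).
apply: filterS => x hx; apply/eqP; rewrite eq_sym -subr_eq0 -/(r x); apply/eqP.
have [[j tj0]|nj] := pselect (exists j : 'I_d, tau j x = 0); first exact: hx tj0.
apply: (@orthonormal_basis_eq0 _ _ (fun j : 'I_d => tau j x)) => [i j|i]; last by rewrite dotvC.
case: eqP => [->|/eqP ij]; last by rewrite (ot x).1.
by case: (utt j x) => // tj0; exfalso; apply: nj; exists j.
Qed.

End frame.

(** * The nearest flat chain *)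

Section flat_chains.
Context {R : realType} {d : nat}.
Local Notation Rd := 'rV[R]_d.
Local Notation B := (borelRd R d).
Implicit Types (s : B -> Rd) (l k eta : vmeasure B R d).

Lemma arens_eells_eq (F G : (Rd -> R) -> R) :
  (forall phi, test_function phi -> F phi = G phi) -> arens_eells F -> arens_eells G.
Proof.
move=> FG [[Flin Fcvg] Fae]; split.
  split=> [a f g tf tg|phi tphi cphi].
    by rewrite -!FG// ?Flin//; exact: test_function_lin.
  by under eq_fun do rewrite -FG//; exact: Fcvg.
move=> phi c tphi L cphi; under eq_fun do rewrite -FG//; exact: Fae L cphi.
Qed.

Lemma ndiv_density_sum (mu : {measure set B -> \bar R}) s phi : L1 mu s ->
  test_function phi ->
  ndiv_density mu s phi = \sum_i \int[mu]_x (partial i phi x * s x 0 i).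
Proof.
move=> si tphi.
have ii i : mu.-integrable setT (EFin \o (fun x => partial i phi x * s x 0 i)).
  have [M hM] := test_function_bounded (test_function_partial i tphi).
  have mp : measurable_fun setT (partial i phi : B -> R).
    by apply: continuous_borelRd_measurable; exact: smooth_continuous (smooth_partial i tphi.1).
  exact: (integrable_bounded_mul mp hM (si i)).
rewrite /Rintegral sum_fine; last by move=> i _; exact: (integrable_fin_num measurableT (ii i)).
rewrite -(integral_sum measurableT ii); congr fine; apply: eq_integral => x _.
by rewrite /dotv sumEFin; congr EFin; apply: eq_bigr => i _; rewrite mxE.
Qed.

Lemma ndiv_has_density (mu : {measure set B -> \bar R}) s l phi :
  has_density mu s l -> test_function phi -> ndiv l phi = ndiv_density mu s phi.
Proof.
move=> [si sl] tphi; have [pi pl] := polar_density l.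
rewrite /ndiv !ndiv_density_sum//; apply: eq_bigr => i _.
have [M hM] := test_function_bounded (test_function_partial i tphi).
apply: (Rintegral_same_charge (pi i) (si i)) hM => [A mA|].
  by rewrite -pl// sl.
by apply: continuous_borelRd_measurable; exact: smooth_continuous (smooth_partial i tphi.1).
Qed.

(** [- div (s mu)] depends only on the vector measure [s mu], so membership in [F1] can
be tested on the density with respect to any measure, not only on the polar
decomposition. *)
Lemma F1_has_density (mu : {measure set B -> \bar R}) s l :
  has_density mu s l -> F1 R d l <-> tangent_fields mu s.
Proof.
move=> sl; split=> [h|[_ h]].
  by split; [exact: sl.1|apply: arens_eells_eq h => phi; exact: ndiv_has_density].
by apply: arens_eells_eq h => phi tphi; rewrite (ndiv_has_density sl).
Qed.

Lemma vnorm_tvar l : `|l| = fine (tvar l setT). Proof. by []. Qed.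

Lemma vnormE l : `|l|%:E = tvar l setT.
Proof. by rewrite vnorm_tvar fineK// fin_num_measure. Qed.

Lemma tvar_le_setT l k : (tvar l setT <= tvar k setT)%E -> `|l| <= `|k|.
Proof. by rewrite -!vnormE lee_fin. Qed.

Lemma has_density_null (mu : {measure set B -> \bar R}) s l A :
  has_density mu s l -> measurable A -> mu A = 0%E -> l A = 0.
Proof.
move=> [si sl] mA A0; apply/rowP => i; rewrite sl// mxE /Rintegral.
by rewrite null_set_integral//; apply: measurable_funTS; exact: (measurable_int mu (si i)).
Qed.

Lemma tvar_null l A : measurable A -> tvar l A = 0%E -> l A = 0.
Proof.
move=> mA A0; apply: enorm_eq0; apply/eqP; rewrite eq_le enorm_ge0 andbT -lee_fin.
by apply: le_trans (enorm_le_tvar l mA) _; rewrite A0.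
Qed.

Lemma tvar_setTD l A : measurable A -> tvar l setT = (tvar l (~` A) + tvar l A)%E.
Proof.
by move=> mA; rewrite -measureU ?setICl//; [rewrite setUC setUv|exact: measurableC].
Qed.

(** Module property of the tangent fields, for an indicator. *)
Lemma F1_restriction eta D : F1 R d eta -> measurable D ->
  exists k, F1 R d k /\ forall A, measurable A -> k A = eta (A `&` D).
Proof.
move=> Fe mD; have pe := polar_density eta.
have mI : measurable_fun setT (\1_D : B -> R) by exact: measurable_indic.
have gi : vintegrable (tvar eta) (fun x => \1_D x *: polar eta x).
  have I1 (x : B) : `|\1_D x : R| <= 1.
    by rewrite indicE; case: (_ \in _); rewrite ?normr1 ?normr0.
  move=> i; have := integrable_bounded_mul mI I1 (pe.1 i).
  by under [X in _ -> integrable _ _ X]eq_fun do rewrite mxE.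
have [k kd] := has_density_ex gi; exists k; split.
  apply/(F1_has_density kd); apply: tangent_fieldsM => //.
  exact/(F1_has_density pe).
move=> A mA; apply/rowP => i; rewrite kd.2// pe.2; last exact: measurableI.
rewrite Rintegral_mkcondr; apply: eq_Rintegral => x _.
by rewrite mxE patch_indic /= mulrC.
Qed.

Section nearest.
Variables (nu : {finite_measure set B -> \bar R}) (tau : 'I_d -> B -> Rd).
Hypothesis ftau : tangent_frame nu tau.
Local Notation proj s := (fun x => projv (fun j => tau j x) (s x)).

Let otau x : orthonormal_or_zero (fun j => tau j x). Proof. by case: ftau. Qed.

Lemma tangent_fields_proj s : L1 nu s -> tangent_fields nu (proj s).
Proof.
case: ftau => tt ot _ si; apply: tangent_fields_projv => // x j.
exact: (ot x).2.
Qed.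

Variables (s : B -> Rd) (l lT : vmeasure B R d).
Hypotheses (sl : has_density nu s l) (slT : has_density nu (proj s) lT).

Lemma proj_F1 : F1 R d lT.
Proof. by apply/(F1_has_density slT)/tangent_fields_proj; case: sl. Qed.

(** Split [eta] into a part absolutely continuous with respect to [nu] and a part
carried by a [nu]-null set. The former has a density in the range of the projection,
so the pointwise Pythagoras identity applies; the latter only adds to the distance. *)
Let dist_proj eta : F1 R d eta ->
  `|l - lT| <= `|l - eta| /\ (`|l - eta| <= `|l - lT| -> eta = lT).
Proof.
move=> Fe.
have [||F hF|A0 [mA0 nA0] hA0] := @exhaustion _ _ _ (tvar eta)
  [set A | measurable A /\ nu A = 0%E].
- by split => //; exact: measure0.
- by move=> A [].
- have mU : measurable (\bigcup_k F k) by apply: bigcup_measurable => k _; exact: (hF k).1.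
  split => //; apply/negligibleP => //; apply: negligible_bigcup => k.
  by apply/negligibleP; [exact: (hF k).1|exact: (hF k).2].
have mC : measurable (~` A0) by exact: measurableC.
have [eta1 [Fe1 eta1E]] := F1_restriction Fe mC.
have [r r1] : exists r, has_density nu r eta1.
  apply: radon_nikodym_density => A mA nA; rewrite eta1E//.
  apply: tvar_null; first exact: measurableI.
  by rewrite -setDE; apply: hA0.
have tr : tangent_fields nu r by apply/(F1_has_density r1).
have {r1} pr1 : has_density nu (proj r) eta1.
  have [k kr] := has_density_ex (tangent_fields_proj r1.1).1.
  rewrite (has_density_uniq _ r1 kr)//; case: ftau => _ _ /(_ _ tr).
  by apply: filterS => x ->.
have null k t : has_density nu t k -> tvar k A0 = 0%E.
  move=> tk; rewrite (tvar_density tk mA0) null_set_integral//.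
  apply/measurable_EFinP; apply: measurable_funTS; apply: vmeasurable_enorm.
  exact: vintegrable_measurable tk.1.
have tE t k : has_density nu t k -> tvar (l - k) setT =
    (\int[nu]_x (enorm (s x - t x))%:E)%E.
  move=> tk; have := has_density_lin (-1) tk sl.
  rewrite (_ : -1 *: k + l = l - k); last by rewrite scaleN1r addrC.
  move=> /tvar_density -> //; apply: eq_integral => x _.
  by rewrite scaleN1r addrC.
have e1 : tvar (l - eta) (~` A0) = tvar (l - eta1) setT.
  rewrite [RHS](tvar_setTD _ mA0).
  have := has_density_lin (-1) pr1 sl; rewrite (_ : -1 *: eta1 + l = l - eta1); last first.
    by rewrite scaleN1r addrC.
  move=> /null ->; rewrite adde0; apply: tvar_ext => A mA AC.
  rewrite -[LHS]/(l A - eta A) -[RHS]/(l A - eta1 A) eta1E//.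
  by rewrite (setIidl AC).
pose f x := enorm (s x - projv (fun j => tau j x) (s x)).
pose g x := enorm (s x - projv (fun j => tau j x) (r x)).
have fi : nu.-integrable setT (EFin \o f).
  apply: (vintegrable_enorm (s := fun x => s x - projv (fun j => tau j x) (s x))).
  have := vintegrable_lin (-1) slT.1 sl.1.
  by congr (vintegrable nu); apply/funext => x; rewrite scaleN1r addrC.
have gi : nu.-integrable setT (EFin \o g).
  apply: (vintegrable_enorm (s := fun x => s x - projv (fun j => tau j x) (r x))).
  have := vintegrable_lin (-1) pr1.1 sl.1.
  by congr (vintegrable nu); apply/funext => x; rewrite scaleN1r addrC.
have fg x : f x <= g x by apply: enorm_sub_projv_le => //; exact: projvK.
have nf : `|l - lT| = \int[nu]_x f x by rewrite vnorm_tvar (tE _ _ slT).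
have ng : `|l - eta1| = \int[nu]_x g x by rewrite vnorm_tvar (tE _ _ pr1).
have split_norm : `|l - eta| = `|l - eta1| + fine (tvar (l - eta) A0).
  by rewrite vnorm_tvar (tvar_setTD _ mA0) fineD ?fin_num_measure// e1.
have le_fg : `|l - lT| <= `|l - eta1| by rewrite nf ng; apply: le_Rintegral.
have A0ge0 : 0 <= fine (tvar (l - eta) A0) by rewrite fine_ge0.
split; first by rewrite split_norm (le_trans le_fg)// lerDl.
rewrite split_norm => le_eq.
(* equality: [eta] has no singular part, and its density is the projection *)
have z1 : fine (tvar (l - eta) A0) = 0.
  apply/eqP; rewrite eq_le A0ge0 andbT -(lerD2l `|l - eta1|) addr0.
  exact: le_trans le_eq le_fg.
have z2 : \int[nu]_x (g x - f x) = 0.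
  rewrite RintegralB// -nf -ng; apply/eqP; rewrite subr_eq0 eq_le le_fg andbT.
  by move: le_eq; rewrite z1 addr0.
have eta_eta1 : eta = eta1.
  apply: vmeasure_eq => A mA.
  have mAA : measurable (A `&` A0) by exact: measurableI.
  have l0 : l (A `&` A0) = 0.
    apply: (has_density_null sl mAA); apply/eqP; rewrite eq_le measure_ge0 andbT -nA0.
    by apply: le_measure; rewrite ?inE.
  have d0 : (l - eta) (A `&` A0) = 0.
    apply: tvar_null => //; apply/eqP; rewrite eq_le measure_ge0 andbT.
    rewrite (_ : 0%E = tvar (l - eta) A0); first by apply: le_measure; rewrite ?inE.
    by rewrite -[RHS]fineK ?fin_num_measure// z1.
  have e0 : eta (A `&` A0) = 0.
    have := d0; rewrite -[LHS]/(l (A `&` A0) - eta (A `&` A0)) l0 sub0r => /eqP.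
    by rewrite oppr_eq0 => /eqP.
  rewrite eta1E//; apply/rowP => i.
  have pe := polar_density eta.
  rewrite !pe.2//; last exact: measurableI.
  have AE : A = (A `&` ~` A0) `|` (A `&` A0) by rewrite -setIUr setUC setUv setIT.
  rewrite [in LHS]AE Rintegral_setU//.
  - by rewrite -[X in _ + X = _]pe.2// e0 mxE addr0.
  - exact: measurableI.
  - by rewrite -AE; apply: integrableS (pe.1 i).
  - by apply/disj_setPS => x [[_ nx] [_ /nx]].
rewrite eta_eta1; apply: has_density_uniq pr1 slT.
have gfi : nu.-integrable setT (EFin \o (fun x => g x - f x)).
  exact: (integrableB measurableT gi fi).
have : ae_eq nu setT (EFin \o (fun x => g x - f x)) (cst 0%E).
  apply/ae_eq_integral_abs => //; first exact: (measurable_int nu gfi).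
  rewrite (eq_integral (fun x => (g x - f x)%:E)); last first.
    by move=> x _; rewrite /= ger0_norm// subr_ge0.
  have := integrable_fin_num measurableT gfi; move=> /fineK <-.
  by rewrite -[fine _]/(\int[nu]_x (g x - f x)) z2.
apply: filterS => x /(_ Logic.I) [] /eqP; rewrite subr_eq0 => /eqP gfx.
have := pythagoras (otau x) (s x) (projvK (otau x) (r x)).
rewrite -/(f x) -/(g x) gfx => /eqP; rewrite addrC -subr_eq subrr eq_sym sqrf_eq0.
by move=> /eqP/enorm_eq0/eqP; rewrite subr_eq0 => /eqP.
Qed.

Lemma nearest_in_F1P k : nearest_in_F1 l k <-> k = lT.
Proof.
have dE : dist l (F1 R d) = `|l - lT|.
  apply/eqP; rewrite eq_le; apply/andP; split.
    apply: ge_inf; first by exists 0 => _ [a _ <-].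
    by exists lT; [exact: proj_F1|rewrite distrC].
  apply: lb_le_inf; first by exists `|lT - l|, lT => //; exact: proj_F1.
  by move=> _ [a Fa <-]; rewrite [leRHS]distrC; exact: (dist_proj Fa).1.
split=> [[Fk]|->]; last by split; [exact: proj_F1|rewrite dE].
by rewrite dE => h; apply: (dist_proj Fk).2; rewrite h.
Qed.

End nearest.
End flat_chains.

(** * The tangent bundle and the projection *)

Section span.
Context {R : realType} {n k : nat}.
Variable t : 'I_k -> 'rV[R]_n.

Definition span_family : {vspace 'rV[R]_n} := <<[tuple t j | j < k]>>%VS.

Lemma mem_span_family (c : 'I_k -> R) : \sum_j c j *: t j \in span_family.
Proof.
apply: memv_suml => j _; apply: memvZ; apply: memv_span.
by apply/tnthP; exists j; rewrite tnth_mktuple.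
Qed.

Lemma span_familyP v : v \in span_family -> exists c : 'I_k -> R, v = \sum_j c j *: t j.
Proof.
move=> /coord_span vE; exists (fun j => coord [tuple t j | j < k] j v); rewrite [LHS]vE.
by apply: eq_bigr => j _; rewrite -tnth_nth tnth_mktuple.
Qed.

Lemma projv_span v : orthonormal_or_zero t -> v \in span_family -> projv t v = v.
Proof.
move=> ot /span_familyP[c ->]; apply: eq_bigr => j _.
rewrite dotv_suml (bigD1 j)//= big1 ?addr0; last first.
  by move=> i ij; rewrite dotvZl ot.1// mulr0.
by rewrite dotvZl; case: (ot.2 j) => [->|->]; rewrite ?scaler0 ?mulr1.
Qed.
End span.

Section norm_one_projection.
Context {R : realType} {V : normedModType R}.
Variables (F : set V) (P : V -> V).
Hypotheses (P_linear : linear P) (P_F : forall v, F (P v))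
  (P_id : forall v, F v -> P v = v) (P_le : forall v, `|P v| <= `|v|).

(** The linear, norm-nonincreasing retraction [P] alone yields the direct sum, whatever
the normed space. *)
Lemma norm_one_projection :
  1.-lipschitz P /\ topological_direct_sum F [set v | P v = 0].
Proof.
have PB u v : P (u - v) = P u - P v.
  by rewrite addrC -scaleN1r P_linear scaleN1r addrC.
have P0 : P 0 = 0 by have := PB 0 0; rewrite !subrr.
have cP : continuous P.
  move=> u U /nbhs_normP[e e0 eU]; apply/nbhs_normP; exists e => // v /= uv.
  by apply: eU; rewrite /= -PB; exact: le_lt_trans (P_le _) uv.
split; first by move=> [u v] _ /=; rewrite mul1r -PB.
split.
- split=> [|a u v Fu Fv]; first by rewrite -P0.
  by rewrite -(P_id Fu) -(P_id Fv) -P_linear.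
- split=> [//|a u v /= Pu Pv].
  by rewrite P_linear Pu Pv scaler0 addr0.
- exists P, (fun v => v - P v); split => //.
    by move=> v; apply: cvgB; [exact: cvg_id|exact: cP].
  move=> v; split => //=.
  + by rewrite PB (P_id (P_F v)) subrr.
  + by rewrite addrC subrK.
  + move=> a b Fa /= Pb ->.
    have -> : P (a + b) = a.
      by rewrite -[a]scale1r P_linear Pb addr0 (P_id Fa).
    by rewrite [a + b]addrC addrK.
Qed.
End norm_one_projection.

Section common.
Context {disp : measure_display} {T : measurableType disp} {R : realType} {n : nat}.
Variables l k : vmeasure T R n.

Definition tvar2 : set T -> \bar R := measure_add (tvar l) (tvar k).

HB.instance Definition _ := Measure.on tvar2.

Lemma tvar2E A : tvar2 A = (tvar l A + tvar k A)%E.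
Proof. by rewrite /tvar2 measure_addE. Qed.

Let tvar2_fin : fin_num_fun tvar2.
Proof. by move=> A mA; rewrite tvar2E fin_numD !fin_num_measure. Qed.

HB.instance Definition _ := Measure_isFinite.Build _ _ _ tvar2 tvar2_fin.

Lemma common_density : exists (mu : {finite_measure set T -> \bar R}) s t,
  has_density mu s l /\ has_density mu t k.
Proof.
have ac (m : vmeasure T R n) : (forall A, (tvar m A <= tvar2 A)%E) ->
    exists s, has_density tvar2 s m.
  move=> mle; apply: radon_nikodym_density => A mA A0.
  apply: enorm_eq0; apply/eqP; rewrite eq_le enorm_ge0 andbT -lee_fin.
  by rewrite (le_trans (enorm_le_tvar m mA))// (le_trans (mle A))// A0.
have [A|s sl] := ac l; first by rewrite tvar2E leeDl.
have [A|t tk] := ac k; first by rewrite tvar2E leeDr.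
by exists tvar2, s, t.
Qed.
End common.

Section projection.
Context {R : realType} {d : nat}.
Local Notation Rd := 'rV[R]_d.
Local Notation B := (borelRd R d).
Implicit Types (s : B -> Rd) (l k eta : vmeasure B R d).

Lemma density0_ae (mu : {finite_measure set B -> \bar R}) s :
  has_density mu s 0 -> {ae mu, forall x, s x = 0}.
Proof.
move=> s0; have e0 : tvar (0 : vmeasure B R d) setT = 0%E by rewrite -vnormE normr0.
have me : measurable_fun setT (fun x => (enorm (s x))%:E).
  by apply/measurable_EFinP/vmeasurable_enorm; exact: vintegrable_measurable s0.1.
have : ae_eq mu setT (fun x => (enorm (s x))%:E) (cst 0%E).
  apply/ae_eq_integral_abs => //; rewrite -e0 (tvar_density s0)//.
  by apply: eq_integral => x _; rewrite gee0_abs ?lee_fin ?enorm_ge0.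
by apply: filterS => x /(_ Logic.I) [] /enorm_eq0.
Qed.

Lemma L1_0 (mu : {measure set B -> \bar R}) : vintegrable mu (fun=> 0 : Rd).
Proof. by move=> i; under eq_fun do rewrite mxE; exact: integrable0. Qed.

Lemma has_density0 (mu : {measure set B -> \bar R}) : has_density mu (fun=> 0 : Rd) 0.
Proof.
split=> [|A mA i]; first exact: L1_0.
by under eq_Rintegral do rewrite mxE; rewrite Rintegral_cst// mul0r mxE.
Qed.

Lemma density_ae0 (mu : {measure set B -> \bar R}) s l :
  {ae mu, forall x, s x = 0} -> has_density mu s l -> l = 0.
Proof. by move=> s0 sl; exact: has_density_uniq s0 sl (has_density0 mu). Qed.

(** For the measurability, an open set meets the span of finitely many vectors if and
only if it contains one of their combinations with rational coefficients. *)
Lemma MK_tangent_bundle_span (mu : {finite_measure set B -> \bar R}) tau :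
  tangent_frame mu tau ->
  MK_tangent_bundle mu (fun x => span_family (fun j => tau j x)).
Proof.
move=> ftau; have [tt ott ht] := ftau; split=> [U oU|s si].
  pose w (q : 'rV[rat]_d) x : Rd := \sum_j ratr (q 0 j) *: tau j x.
  have mw q : vmeasurable (w q).
    move=> i; have -> : (fun x => w q x 0 i) = fun x => \sum_j ratr (q 0 j) * tau j x 0 i.
      by apply/funext => x; rewrite summxE; apply: eq_bigr => j _; rewrite mxE.
    apply: measurable_sum => j; apply: measurable_funM => //.
    exact: tangent_fields_measurable (tt j) i.
  exists (\bigcup_q (w q @^-1` U)).
    by apply: countable_bigcupT_measurable => // q; exact: measurable_preimage_open.
  rewrite (_ : [set x | _] = \bigcup_q (w q @^-1` U)).
    by rewrite setDv setU0; exact: negligible_set0.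
  apply/seteqP; split=> x; last first.
    by move=> [q _ Uq]; exists (w q x) => //; exact: mem_span_family.
  move=> [v /span_familyP[c ->] Uv].
  pose F (b : Rd) : Rd := \sum_j b 0 j *: tau j x.
  have cF : continuous F.
    move=> b; have nf : Filter (nbhs b) by exact: nbhs_filter.
    apply: (@cvg_big _ _ _ _ _ add_continuous _ _ _ _ _ nf) => j _.
    have cb : ((y : Rd) 0 j : R) @[y --> b] --> (b 0 j : R) by exact: coord_continuous.
    exact: cvgZr_tmp cb.
  have oV : open (F @^-1` U) by move/continuousP : cF; exact.
  have Vc : (F @^-1` U) (\row_j c j).
    by rewrite /= /F; under eq_bigr do rewrite mxE.
  move: (Vc); rewrite {1}(open_bigcup_rat_box oV) => -[[p q] /= pqV pqc].
  pose m : 'rV[rat]_d := \row_j ((p 0 j + q 0 j) / 2).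
  exists m => //.
  have : (F @^-1` U) (map_mx ratr m).
    apply: pqV => j; have := pqc j; rewrite /= !mxE rmorphM rmorphD fmorphV /=.
    rewrite [ratr 2]ratr_nat => /andP[h1 h2].
    by apply/andP; split; lra.
  by rewrite /= /F /w; under eq_bigr do rewrite mxE.
split=> [ts|sT].
  by move: (ht _ ts); apply: filterS => x <-; exact: mem_span_family.
apply: tangent_fields_ae si (tangent_fields_proj ftau si).
by move: sT; apply: filterS => x; exact: projv_span.
Qed.

Lemma nearest_ex_unique l : exists! lT, nearest_in_F1 l lT.
Proof.
have [tau ftau] := tangent_frame_ex (tvar l).
have pl := polar_density l.
have [k kd] := has_density_ex (tangent_fields_proj ftau pl.1).1.
exists k; split; first by apply/(nearest_in_F1P ftau pl kd).
by move=> k' /(nearest_in_F1P ftau pl kd).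
Qed.

Section projection_map.
Variable P : vmeasure B R d -> vmeasure B R d.
Hypothesis hP : forall l, nearest_in_F1 l (P l).

Let P_density (mu : {finite_measure set B -> \bar R}) tau s l :
  tangent_frame mu tau -> has_density mu s l ->
  has_density mu (fun x => projv (fun j => tau j x) (s x)) (P l).
Proof.
move=> ftau sl; have [k kd] := has_density_ex (tangent_fields_proj ftau sl.1).1.
by have -> : P l = k by apply/(nearest_in_F1P ftau sl kd).
Qed.

Let P_F1 l : F1 R d (P l). Proof. exact: (hP l).1. Qed.

Let P_id l : F1 R d l -> P l = l.
Proof.
move=> Fl; have [k [_ uk]] := nearest_ex_unique l.
rewrite -(uk _ (hP l)); apply: uk; split => //; rewrite subrr normr0.
apply/esym/eqP; rewrite eq_le; apply/andP; split.
  apply: ge_inf; first by exists 0 => _ [a _ <-].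
  by exists l => //; rewrite subrr normr0.
by apply: lb_le_inf => [|_ [a _ <-]//]; exists `|l - l|, l.
Qed.

Let P_linear : linear P.
Proof.
move=> a l k; have [mu [s [t [sl tk]]]] := common_density l k.
have [tau ftau] := tangent_frame_ex mu.
have d1 := P_density ftau (has_density_lin a sl tk).
have d2 := has_density_lin a (P_density ftau sl) (P_density ftau tk).
apply: has_density_uniq d1 d2.
by apply: aeW => x; exact: projv_lin.
Qed.

Let P_le l : `|P l| <= `|l|.
Proof.
have [tau ftau] := tangent_frame_ex (tvar l); have [_ ot _] := ftau.
have pl := polar_density l; have Pd := P_density ftau pl.
apply: tvar_le_setT; rewrite (tvar_density Pd)// [leRHS](tvar_density pl)//.
apply: ge0_le_integral => //.
- by move=> x _; rewrite lee_fin enorm_ge0.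
- by apply/measurable_EFinP/vmeasurable_enorm; exact: vintegrable_measurable Pd.1.
- by apply/measurable_EFinP/vmeasurable_enorm; exact: vintegrable_measurable pl.1.
- by move=> x _; rewrite lee_fin; exact: enorm_projv_le.
Qed.

Let P_ker : [set l | P l = 0] = F1_perp R d.
Proof.
apply/seteqP; split=> l /=.
  move=> Pl0; have [tau ftau] := tangent_frame_ex (tvar l); have [_ ot _] := ftau.
  exists (fun x => span_family (fun j => tau j x)); first exact: MK_tangent_bundle_span.
  have pl := polar_density l; have := P_density ftau pl; rewrite Pl0 => /density0_ae.
  apply: filterS => x px u /span_familyP[c ->].
  rewrite dotv_suml big1// => j _; rewrite dotvZl dotvC.
  by rewrite -(dotv_projv_t (ot x)) px dotv0l mulr0.
move=> [T [_ hT] pT]; have [tau ftau] := tangent_frame_ex (tvar l).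
have [tt _ _] := ftau; have pl := polar_density l.
apply: (density_ae0 _ (P_density ftau pl)).
have tT : {ae tvar l, forall x, forall j, tau j x \in T x}.
  by apply: filter_forall => j; apply/(hT _ (tt j).1); exact: tt.
move: pT tT; apply: filterS2 => x px tx.
by rewrite /projv big1// => j _; rewrite dotvC (px _ (tx j)) scale0r.
Qed.

Lemma projection_properties :
  [/\ linear P, 1.-lipschitz P,
      topological_direct_sum (F1 R d) [set l | P l = 0] &
      [set l | P l = 0] = F1_perp R d].
Proof.
have [lipP sumP] := norm_one_projection P_linear P_F1 P_id P_le.
by split.
Qed.
End projection_map.
End projection.

Theorem theorem3p5 (R : realType) (d : nat) :
  (forall lambda : vmeasure (borelRd R d) R d,
    exists! lambdaT, nearest_in_F1 lambda lambdaT) /\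
  (forall P : vmeasure (borelRd R d) R d -> vmeasure (borelRd R d) R d,
    (forall lambda, nearest_in_F1 lambda (P lambda)) ->
    [/\ linear P,
        1.-lipschitz P,
        topological_direct_sum (F1 R d) [set lambda | P lambda = 0] &
        [set lambda | P lambda = 0] = F1_perp R d]).
Proof.
split=> [lambda|P hP]; first exact: nearest_ex_unique.
exact: projection_properties.
Qed.
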